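(* Let $r\in\mathbb N$ with $r\ge3$ and let $L:\mathbb R^+\to[0,\infty)$ satisfy all of the following. (1) For any $0<x_1<x_2$, $L$ is of bounded variation on $[x_1,x_2]$. (2) $L$ has a finite number of discontinuities in $\mathbb R^+$. (3) There exists a real $K<r$ such that $L(x)$ is $\Theta(x^K)$ as $x\to0$, and there exists a real $K'<r$ such that $L(x)$ is $\Theta(x^{K'})$ as $x\to\infty$. (4) There exists $\xi\in\mathbb R^+$ such that $L$ is non-increasing on $(0,\xi)$ and $\int_{\xi}^\infty \frac{L(\xi)-L(x)}{x^{r+1}}\,dx>0$. (5) There exists $\xi'\in\mathbb R^+$ such that $L$ is non-decreasing on $(\xi',\infty)$ and one of these conditions holds: (a) $L(\xi'-)<L(\xi'+)$; or (b) there is $t\in\mathbb N$ such that $L$ is of class $C^t$ on an interval containing $\xi'$, $\frac{d^iL}{dx^i}(\xi')=0$ for $i=1,\dots,t-1$, and $(-1)^{t-1}\frac{d^tL}{dx^t}(\xi')>0$. Let $\Omega^*\in\mathbb R^+$ be a value minimizing $\bar\eta(\Omega)$ over $\Omega\in\mathbb R^+$. Suppose that for some $\upsilon,\upsilon'\in\mathbb R^+$ with $$\upsilon\le\frac{\Omega^*}{r+\sqrt r+1},\qquad \upsilon'\ge\frac{\Omega^*}{r-\sqrt r},$$ $L$ is constant on $[\upsilon,\upsilon']$, non-increasing on $(0,\upsilon]$, and non-decreasing on $[\upsilon',\infty)$. Then the estimator $\hat p=\frac{\Omega^*}{N+1}$ minimizes $\sup_{p\in(0,1)}\eta(p)$ among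 all (possibly randomized) estimators based on inverse binomial sampling.
   Context: $\mathbb R^+=(0,\infty)$, $\mathbb N=\{1,2,\dots\}$. $h(a-)$, $h(a+)$ denote one-sided limits. $h_1(x)$ is $\Theta(h_2(x))$ as $x\to0$ (resp. $x\to\infty$) if there are $a,m,M\in\mathbb R^+$ with $m h_2(x)\le h_1(x)\le M h_2(x)$ for all $x\le a$ (resp. $x\ge a$). Inverse binomial sampling: for $p\in(0,1)$, $N$ is the number of i.i.d. Bernoulli($p$) trials needed to obtain $r$ successes, so $f(n)=\Pr[N=n]=\binom{n-1}{r-1}p^r(1-p)^{n-r}$ for $n\ge r$. A (possibly randomized) estimator $\hat p$ of $p$ is specified by a family $(\Pi_n)_{n\ge r}$ of distribution functions of positive random variables, not depending on $p$; $\Pi_n$ is the distribution function of $\hat p$ conditioned on $N=n$. Its risk is $\eta(p)=\mathrm E[L(\hat p/p)]=\sum_{n=r}^\infty f(n)\int_0^\infty L(y/p)\,d\Pi_n(y)\in[0,\infty]$. A non-randomized estimator $\hat p=g(N)$, with $g$ positive, is the case where each $\Pi_n$ is a point mass at $g(n)$. For $\Omega\in\mathbb R^+$, $\bar\eta(\Omega)=\int_0^\infty\phi(\nu)L(\Omega/\nu)\,d\nu$ with $\phi(\nu)=\nu^{r-1}e^{-\nu}/(r-1)!$. *)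

(* Defs.v *)
From HB Require Import structures.
From mathcomp Require Import all_boot all_order all_algebra.
From mathcomp Require Import all_classical all_reals all_analysis.

Set Implicit Arguments.
Unset Strict Implicit.
Unset Printing Implicit Defensive.

Import Order.TTheory GRing.Theory Num.Theory.
Import numFieldNormedType.Exports.

Local Open Scope classical_set_scope.
Local Open Scope ring_scope.

(* Functions on the positive reals are total functions R -> R, of which only
   the values at positive arguments matter. *)

Section growth.
Context {R : realType}.

Definition Theta_at0 (h1 h2 : R -> R) : Prop :=
  exists a m M : R, [/\ 0 < a, 0 < m, 0 < M &
    forall x, 0 < x <= a -> m * h2 x <= h1 x <= M * h2 x].

Definition Theta_aty (h1 h2 : R -> R) : Prop :=
  exists a m M : R, [/\ 0 < a, 0 < m, 0 < M &
    forall x, a <= x -> m * h2 x <= h1 x <= M * h2 x].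

End growth.

(* Derivatives relative to a set A: the variable stays in A. At an interior
   point of A this is the ordinary derivative; at an endpoint of an interval A
   it is the one-sided derivative. *)
Section derivatives_within.
Context {R : realType}.
Implicit Types (A : set R) (f : R -> R) (x : R).

Definition derivable_within A f x : Prop :=
  cvg ((f y - f x) / (y - x) @[y --> within A x^']).

Definition derive_within A f x : R :=
  lim ((f y - f x) / (y - x) @[y --> within A x^']).

Definition nderive_within A (i : nat) f : R -> R := iter i (derive_within A) f.

Definition class_C (t : nat) A f : Prop :=
  (forall i x, (i < t)%N -> A x -> derivable_within A (nderive_within A i f) x)
  /\ {within A, continuous (nderive_within A t f)}.

End derivatives_within.

Section point_mass.
Context {R : realType}.

Definition step_cdf (a : R) : R -> R := fun x => (a <= x)%R%:R.

Variable a : R.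

Let step_nd : {homo step_cdf a : x y / x <= y}.
Proof.
move=> x y xy; rewrite /step_cdf ler_nat.
by case: (leP a x) => //= ax; rewrite (le_trans ax xy).
Qed.

Let step_rc : right_continuous (step_cdf a).
Proof.
move=> x; apply: cvg_near_cst.
have [ax|xa] := leP a x; near=> y; apply/eqP; rewrite /step_cdf.
  by rewrite ax (le_trans ax)//; near: y; exact: nbhs_right_ge.
by rewrite (lt_geF xa) lt_geF//; near: y; exact: nbhs_right_lt.
Unshelve. all: by end_near. Qed.

HB.instance Definition _ :=
  isCumulative.Build R _ R (step_cdf a) step_nd step_rc.

Let step_Ny : step_cdf a x @[x --> -oo] --> (0 : R).
Proof.
apply: (@cvg_near_cst _ R); near=> x; apply/eqP; rewrite /step_cdf lt_geF//.
by near: x; apply: nbhs_ninfty_lt; exact: num_real.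
Unshelve. all: by end_near. Qed.

Let step_y : step_cdf a x @[x --> +oo] --> (1 : R).
Proof.
apply: (@cvg_near_cst _ R); near=> x; apply/eqP; rewrite /step_cdf.
suff -> : a <= x by [].
by near: x; apply: nbhs_pinfty_ge; exact: num_real.
Unshelve. all: by end_near. Qed.

HB.instance Definition _ :=
  isCumulativeBounded.Build R 0 1 (step_cdf a) step_Ny step_y.

(* The distribution function of the point mass at a. *)
Definition point_mass : cumulativeBounded (0 : R) (1 : R) := step_cdf a.

End point_mass.

Section inverse_binomial_sampling.
Context {R : realType}.
Implicit Types (r n : nat) (L : R -> R) (p Omega : R).

(* Pr[N = n] for n >= r, where N is the number of Bernoulli(p) trials needed
   to obtain r successes. *)
Definition ibs_pmf r p n : R :=
  'C(n.-1, r.-1)%:R * p ^+ r * (1 - p) ^+ (n - r).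

(* Pi n is the distribution function of the estimator conditioned on N = n;
   only the indices n >= r matter. *)
Definition family := nat -> cumulativeBounded (0 : R) (1 : R).

(* Pi n 0 = 0 says that the random variable is almost surely positive. *)
Definition estimator r (Pi : family) : Prop :=
  forall n, (r <= n)%N -> Pi n 0 = 0.

Definition nonrandomized (g : nat -> R) : family := fun n => point_mass (g n).

Definition risk r L (Pi : family) p : \bar R :=
  (\sum_(r <= n <oo) ((ibs_pmf r p n)%:E *
     \int[lebesgue_stieltjes_measure (Pi n)]_(y in `]0%R, +oo[)
       (L (y / p))%:E))%E.

Definition sup_risk r L (Pi : family) : \bar R :=
  ereal_sup [set risk r L Pi p | p in `]0, 1[].

Definition minimax r L (Pi : family) : Prop :=
  estimator r Pi /\
  forall Pi', estimator r Pi' -> (sup_risk r L Pi <= sup_risk r L Pi')%E.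

Definition phi r (nu : R) : R := nu ^+ r.-1 * expR (- nu) / (r.-1)`!%:R.

Definition asym_risk r L Omega : \bar R :=
  (\int[lebesgue_measure]_(nu in `]0%R, +oo[)
     (phi r nu * L (Omega / nu))%:E)%E.

End inverse_binomial_sampling.

(* Main.v *)
Require Import Defs.
From HB Require Import structures.
From mathcomp Require Import all_boot all_order all_algebra.
From mathcomp Require Import all_classical all_reals all_analysis.
From mathcomp Require Import measurable_realfun ring lra zify.

Set Implicit Arguments.
Unset Strict Implicit.
Unset Printing Implicit Defensive.

Import Order.TTheory GRing.Theory Num.Theory.
Import numFieldNormedType.Exports.

Local Open Scope classical_set_scope.
Local Open Scope ring_scope.

(** A Bayes argument gives the lower bound: against the improper prior [dp / p]
    restricted to small [p], the posterior of [n * p] given [N = n] is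
    asymptotically Gamma with shape [r], so no estimator has a supremum risk
    below [min asym_risk].

    For the upper bound put [X = (N + 1) p] and [l u = L (Omega / u)], which is
    non-increasing, then constant, then non-decreasing.  Stationarity of
    [asym_risk] at [Omega] reads [\int (u - r) phi l = 0], hence passing from the
    Gamma density [phi r] to the mixture [(1 - p) phi r + p phi r.+1] does not
    increase the integral of [l].  Both tails of [X] are lighter than those of this
    mixture, left of [r - sqrt r] and right of [r + sqrt r + 1].  Indeed the
    binomial tails at [n] are dominated by Poisson tails of mean [n p] as soon as
    [r <= (n p - r)^2], and the mixture makes up for the difference between
    [n p] and [(n + 1) p].  (Against [phi r] itself the right tail comparison
    fails for [r = 3] and small [p].) *)

(** Stationarity rests on the identity [u * phi r u = r * phi r.+1 u]: it says that [Omega] has the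
    same risk against the Gamma shapes [r] and [r.+1]. Only one inequality between the two is
    required; it comes from comparing [Omega] with [(1 + d) * Omega] after moving the factor [1 + d]
    from the loss onto the smooth density, so that no derivative of [L] appears. The thresholds have
    two sources. The condition [r <= (n p - r)^2] keeps [n p] out of the open interval from
    [r - sqrt r] to [r + sqrt r], and passing from [n p] to [(n + 1) p] costs at most [p < 1], which
    is the extra [1] on the right; on the left the shift goes the favourable way. In the lower bound
    the obstacle is uniformity: the Gamma approximation of the pmf holds only for bounded [n p],
    while an estimator may take arbitrary values. Hence the risk restricted to a window [[1 / A, A]]
    must be nearly minimal for all scales at once. Cutting the prior at both ends then costs
    [2 ln A], which is negligible because its logarithmic mass is unbounded. *)

Section real_inequalities.
Context {R : realType}.
Implicit Types (f df : R -> R) (a b s t w x y z : R).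

Lemma is_derive_ge0_le f df a b : a <= b ->
  (forall x, a <= x <= b -> is_derive x 1 f (df x)) ->
  (forall x, a <= x <= b -> 0 <= df x) -> f a <= f b.
Proof.
move=> ab fdf df0.
have cf : {within `[a, b], continuous f}.
  apply: derivable_within_continuous => x; rewrite in_itv/= => xab.
  by have := fdf x xab; case.
have [|x xab E] := @MVT_segment R f df a b ab _ cf.
  by move=> x; rewrite in_itv/= => /andP[ax xb]; apply: fdf; rewrite !ltW.
by rewrite -subr_ge0 E mulr_ge0 ?subr_ge0// df0// -in_itv.
Qed.

(** Logarithm minus its second-order Taylor polynomial at [1]. The derivative is [(s - 1) ^+ 2 / s],
    so the function increases through its zero at [1]: one monotonicity gives bounds of opposite
    sense on the two sides. *)
Let taylor s : R := ln s - (s - 1) + (s - 1) ^+ 2 / 2.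

Let taylor_le x y : 0 < x -> x <= y -> taylor x <= taylor y.
Proof.
move=> x0 xy.
apply: (@is_derive_ge0_le _ (fun s => (s - 1) ^+ 2 / s)) => // s /andP[xs _].
  have s0 : 0 < s by exact: lt_le_trans xs.
  have := is_derive1_ln s0 => ?.
  apply: is_derive_eq; rewrite /GRing.scale/=.
  by field; rewrite gt_eqF.
by rewrite divr_ge0 ?sqr_ge0// ltW// (lt_le_trans x0).
Qed.

Lemma ln_ge_taylor2 s : 1 <= s -> (s - 1) - (s - 1) ^+ 2 / 2 <= ln s.
Proof. by move=> s1; have := taylor_le ltr01 s1; rewrite /taylor ln1; lra. Qed.

Lemma ln_le_taylor2 s : 0 < s -> s <= 1 -> ln s <= (s - 1) - (s - 1) ^+ 2 / 2.
Proof. by move=> s0 s1; have := taylor_le s0 s1; rewrite /taylor ln1; lra. Qed.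

(** Padé bound, matching the exponential to second order at [0]. The difference of the two sides has
    derivative [1 - expR t * (1 - t)], nonnegative because [1 - t <= expR (- t)]. *)
Lemma expR_pade z : 0 <= z -> expR z * (2 - z) <= 2 + z.
Proof.
move=> z0; rewrite -subr_ge0.
pose f t := 2 + t - expR t * (2 - t).
suff : f 0 <= f z by rewrite /f expR0; lra.
apply: (@is_derive_ge0_le _ (fun t => 1 - expR t * (1 - t))) => // t _.
  by apply: is_derive_eq; rewrite /GRing.scale/=; ring.
rewrite subr_ge0 -[leRHS](expRxMexpNx_1 t) ler_pM2l ?expR_gt0//.
exact: expR_ge1Dx.
Qed.

End real_inequalities.

(** * Falling factorials against powers: the core of the binomial-Poisson comparison *)

Section poisson_comparison.
Context {R : realType}.
Implicit Types (n r j : nat) (p v w x y : R).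

(** [lnD v] is the gap between [ln (x / v)] and its tangent at [v]; [prim v] is the antiderivative
    of [lnD v] that vanishes at [v], and [primp v] is this antiderivative frozen to the left of
    [v]. *)
Let lnD v x : R := (x - v) / v - ln (x / v).
Let prim v x : R := (x - v) ^+ 2 / (2 * v) - x * ln (x / v) + (x - v).
Let primp v x : R := prim v (Num.max x v).

(** Convexity of [prim v] to the right of [v], where its derivative [lnD v] increases. Concretely
    this is [ln_ge_taylor2] at [x / y], with the denominator [2 * y] of the error relaxed to
    [2 * v]. *)
Let prim_convex v x y : 0 < v -> v <= y -> y <= x ->
  prim v x - prim v y <= (x - y) * lnD v x.
Proof.
move=> v0 vy yx; have y0 : 0 < y by exact: lt_le_trans vy.
have x0 : 0 < x by exact: lt_le_trans yx.
have := @ln_ge_taylor2 R (x / y); rewrite ler_pdivlMr// mul1r => /(_ yx) h.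
rewrite /prim /lnD !ln_div ?posrE//; rewrite ln_div ?posrE// in h.
have : (x - y) - (x - y) ^+ 2 / (2 * y) <= y * (ln x - ln y).
  have := ler_wpM2l (ltW y0) h.
  rewrite (_ : y * (_ - _ / 2) = (x - y) - (x - y) ^+ 2 / (2 * y))//.
  by field; rewrite gt_eqF.
have : (x - y) ^+ 2 / (2 * y) <= (x - y) ^+ 2 / (2 * v).
  by rewrite ler_wpM2l ?sqr_ge0// lef_pV2 ?posrE ?mulr_gt0// ler_pM2l.
have -> : (x - v) ^+ 2 / (2 * v) = (y - v) ^+ 2 / (2 * v)
    + (x - y) * ((x - v) / v) - (x - y) ^+ 2 / (2 * v).
  by field; rewrite gt_eqF.
lra.
Qed.

Let prim_refl v : 0 < v -> prim v v = 0.
Proof. by move=> v0; rewrite /prim subrr divff ?gt_eqF// ln1; ring. Qed.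

Let lnD_ge0 v x : 0 < v -> 0 < x -> 0 <= lnD v x.
Proof.
move=> v0 x0; rewrite /lnD; have xv : 0 < x / v by exact: divr_gt0.
have := @le_ln1Dx R (x / v - 1); rewrite ltrBrDl subrr => /(_ xv).
rewrite addrC subrK mulrBl divff ?gt_eqF//; lra.
Qed.

(** A unit cell ending at [x] contributes at most the value of [lnD v] at its right end. Freezing at
    [v] shortens or removes the cell, which is harmless because [lnD v] is nonnegative. *)
Let primp_step v x : 0 < v -> 0 < x -> primp v x - primp v (x - 1) <= lnD v x.
Proof.
move=> v0 x0; rewrite /primp; have g0 := lnD_ge0 v0 x0.
have [vx|xv] := leP v x; last first.
  by rewrite max_r ?subrr//; lra.
rewrite (le_trans (prim_convex v0 _ _)) ?le_max ?lexx ?orbT//.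
  by rewrite ge_max; lra.
rewrite ler_piMl// lerBlDr addrC -lerBlDr le_max; lra.
Qed.

(* Comparison of the sum with [r] unit cells of the integral of [ln (x / v)]. *)
Let sum_ln_le n r v : (r <= n)%N -> 0 < v -> n%:R - r%:R <= v -> v <= n%:R ->
  (n%:R - v) + n%:R * ln (v / n%:R) + \sum_(j < r) ln ((n%:R - j%:R) / v)
  <= (r%:R - (r%:R - (n%:R - v)) ^+ 2) / (2 * v).
Proof.
move=> rn v0 nrv vn; have n0 : 0 < n%:R :> R by exact: lt_le_trans vn.
have tele m : (m <= r)%N ->
    primp v n%:R - primp v (n%:R - m%:R) <= \sum_(j < m) lnD v (n%:R - j%:R).
  elim: m => [_|m IH mr]; first by rewrite subr0 subrr big_ord0.
  have /(primp_step v0) : 0 < n%:R - m%:R :> R.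
    by rewrite subr_gt0 ltr_nat (leq_trans mr).
  rewrite big_ord_recr/=; have := IH (ltnW mr).
  by rewrite (_ : n%:R - m%:R - 1 = n%:R - m.+1%:R); [lra|rewrite -natr1; ring].
have := tele _ (leqnn r).
(* Since [n - r <= v <= n], the telescoped sum is exactly [prim v n]: its lower end is frozen at
   [prim v v = 0]. *)
rewrite {1 2}/primp max_l// max_r// prim_refl// subr0.
have -> : \sum_(j < r) lnD v (n%:R - j%:R) =
    (r%:R * (n%:R - v) - r%:R * (r%:R - 1) / 2) / v
    - \sum_(j < r) ln ((n%:R - j%:R) / v).
  rewrite big_split/= sumrN; congr (_ - _); rewrite -mulr_suml; congr (_ / _).
  elim: (r) => [|m IH]; first by rewrite big_ord0; ring.
  by rewrite big_ord_recr/= IH -natr1; field.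
rewrite /prim !ln_div ?posrE// => h.
(* With [d = n - v], completing the square in [2 r d - r (r - 1) - d^2] gives [r - (r - d)^2]; this
   is where the deviation [sqrt r] originates. *)
rewrite (_ : _ / (2 * v) = (r%:R * (n%:R - v) - r%:R * (r%:R - 1) / 2) / v
   - (n%:R - v) ^+ 2 / (2 * v)); first lra.
by field; rewrite gt_eqF.
Qed.

(** Divided by a factorial, this dominates binomial probabilities by Poisson ones of mean [n p], at
    [r] for [n] trials and at [r.-1] for [n.-1] trials. In logarithms it is [sum_ln_le] at a
    well-chosen [v], the deviation hypothesis making the remainder nonpositive. *)
Lemma ffact_poisson_le n r p : (0 < r <= n)%N -> 0 < p < 1 ->
  r%:R <= (n%:R * p - r%:R) ^+ 2 ->
  (n ^_ r)%:R * (1 - p) ^+ (n - r) * expR (n%:R * p) <= n%:R ^+ r.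
Proof.
move=> /andP[r0 rn] /andP[p0 p1] H.
have n0 : 0 < n%:R :> R by rewrite ltr0n (leq_trans r0).
have q0 : 0 < 1 - p by lra.
have prodE : (n ^_ r)%:R = \prod_(j < r) (n%:R - j%:R) :> R.
  rewrite ffact_prod natr_prod; apply: eq_bigr => j _.
  by rewrite natrB// (leq_trans (ltnW (ltn_ord j))).
have nj (j : 'I_r) : 0 < n%:R - j%:R :> R.
  by rewrite subr_gt0 ltr_nat (leq_trans (ltn_ord j)).
have ln_prod m : (m <= r)%N ->
   ln (\prod_(j < m) (n%:R - j%:R)) = \sum_(j < m) ln (n%:R - j%:R) :> R.
  elim: m => [_|m IH mr]; first by rewrite !big_ord0 ln1.
  rewrite !big_ord_recr/= lnM ?IH ?posrE ?(ltnW mr)//.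
    apply: prodr_gt0 => j _; rewrite subr_gt0 ltr_nat.
    by rewrite (leq_trans (ltn_ord j))// (leq_trans (ltnW mr)).
  exact: (nj (Ordinal mr)).
have fn0 : 0 < \prod_(j < r) (n%:R - j%:R) :> R by exact: prodr_gt0.
rewrite prodE -ler_ln ?posrE ?mulr_gt0 ?exprn_gt0 ?expR_gt0//.
rewrite !lnM ?posrE ?mulr_gt0 ?exprn_gt0 ?expR_gt0// expRK !lnXn// ln_prod//.
rewrite -[ln n%:R *+ r]mulr_natl -[_ *+ (n - r)]mulr_natl natrB//.
have sumE v : 0 < v -> \sum_(j < r) ln ((n%:R - j%:R) / v) =
    \sum_(j < r) ln (n%:R - j%:R) - r%:R * ln v :> R.
  move=> v0; under eq_bigr do rewrite ln_div ?posrE//.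
  by rewrite big_split/= sumrN sumr_const card_ord mulr_natl.
(* The choice [v = n (1 - p)] turns the left side of [sum_ln_le] into the wanted difference of
   logarithms; it is admissible when [n - r <= v], that is when [n p <= r]. *)
have [npr|rnp] := leP (n%:R * p) r%:R.
  have v0 : 0 < n%:R * (1 - p) by rewrite mulr_gt0.
  have nv : n%:R - r%:R <= n%:R * (1 - p) by lra.
  have vn : n%:R * (1 - p) <= n%:R by rewrite ger_pMr//; lra.
  have := sum_ln_le rn v0 nv vn.
  have -> : n%:R - n%:R * (1 - p) = n%:R * p by ring.
  have : (r%:R - (r%:R - n%:R * p) ^+ 2) / (2 * (n%:R * (1 - p))) <= 0.
    rewrite pmulr_lle0 ?invr_gt0 ?mulr_gt0//.
    by rewrite -sqrrN opprB; lra.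
  rewrite sumE// ln_div ?posrE// lnM ?posrE//.
  set A := _ / (2 * _); set C := \sum_(_ < _) _ => A0.
  move: (ln n%:R) (ln (1 - p)) => a b.
  lra.
(* Now [n (1 - p) < n - r], so [v] stops at the smallest admissible value [n - r], which leaves an
   excess [r / (2 v)]. The second-order bound on the logarithm of [n (1 - p) / v] pays it back with
   [(n p - r)^2 / (2 v)]. *)
have rn' : (r < n)%N.
  rewrite -(ltr_nat R) (lt_trans rnp)// -[ltRHS]mulr1 ltr_pM2l//.
have v0 : 0 < n%:R - r%:R :> R by rewrite subr_gt0 ltr_nat.
have nr : n%:R - r%:R <= n%:R :> R by rewrite gerBl.
have := sum_ln_le rn v0 (lexx _) nr; rewrite sumE// ln_div ?posrE//.
set v : R := n%:R - r%:R.
rewrite (_ : r%:R - (n%:R - v) = 0) ?expr0n/= ?subr0; last by rewrite /v; ring.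
rewrite (_ : n%:R - v = r%:R); last by rewrite /v; ring.
have s0 : 0 < n%:R * (1 - p) / v by rewrite divr_gt0// mulr_gt0.
have s1 : n%:R * (1 - p) / v <= 1 by rewrite ler_pdivrMr// /v; lra.
have := ler_wpM2l (ltW v0) (ln_le_taylor2 s0 s1).
rewrite ln_div ?posrE ?mulr_gt0// lnM ?posrE//.
have -> : v * (n%:R * (1 - p) / v - 1 - (n%:R * (1 - p) / v - 1) ^+ 2 / 2) =
    (r%:R - n%:R * p) - (n%:R * p - r%:R) ^+ 2 / (2 * v).
  by rewrite /v; field; rewrite gt_eqF.
have : r%:R / (2 * v) <= (n%:R * p - r%:R) ^+ 2 / (2 * v).
  by rewrite ler_pM2r// invr_gt0 mulr_gt0.
set A := (_ ^+ 2 / _); set B := r%:R / _; set C := \sum_(_ < _) _.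
have : n%:R = r%:R + v by rewrite /v; ring.
move: (ln n%:R) (ln (1 - p)) (ln v) => a b c -> AB.
lra.
Qed.

End poisson_comparison.

(** * Poisson and binomial tails *)

Section poisson_binomial_tails.
Context {R : realType}.
Implicit Types (n m k r : nat) (p x y z : R).

Definition poisson_term k x : R := x ^+ k * expR (- x) / k`!%:R.

(** For positive [r] this is also the probability that a Gamma variable of shape [r] exceeds [x]. *)
Definition poisson_tail r x : R := \sum_(k < r) poisson_term k x.

Definition binomial_term m k p : R := 'C(m, k)%:R * p ^+ k * (1 - p) ^+ (m - k).

(** Fewer than [r] successes in [m] trials: the event [N > m]. *)
Definition binomial_tail m r p : R := \sum_(k < r) binomial_term m k p.

Lemma phiE r x : phi r x = poisson_term r.-1 x.
Proof. by []. Qed.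

Lemma poisson_term_ge0 k x : 0 <= x -> 0 <= poisson_term k x.
Proof. by move=> x0; rewrite !mulr_ge0 ?exprn_ge0 ?expR_ge0 ?invr_ge0. Qed.

Lemma poisson_term_gt0 k x : 0 < x -> 0 < poisson_term k x.
Proof.
move=> x0; rewrite !mulr_gt0 ?exprn_gt0 ?expR_gt0 ?invr_gt0// ltr0n fact_gt0.
Qed.

Lemma poisson_termS k x : poisson_term k.+1 x = x / k.+1%:R * poisson_term k x.
Proof.
rewrite /poisson_term factS natrM exprS; field.
by rewrite !pnatr_eq0 -lt0n fact_gt0 addrC natr1 pnatr_eq0.
Qed.

Lemma binomial_term_ge0 m k p : 0 < p < 1 -> 0 <= binomial_term m k p.
Proof.
move=> /andP[p0 p1]; rewrite !mulr_ge0 ?exprn_ge0 ?subr_ge0//; exact: ltW.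
Qed.

Lemma binomial_term_step m k p : (k < m)%N ->
  binomial_term m k.+1 p * (k.+1%:R * (1 - p)) = binomial_term m k p * ((m - k)%:R * p).
Proof.
move=> km; rewrite /binomial_term.
have h : k.+1%:R * 'C(m, k.+1)%:R = (m - k)%:R * 'C(m, k)%:R :> R.
  by rewrite -!natrM mul_bin_left.
have AC (a b c d s t u : R) : a * b = c * d ->
    b * (p * s) * t * (a * u) = d * s * (u * t) * (c * p).
  move=> abcd; transitivity (a * b * (p * s * t * u)); first by ring.
  by rewrite abcd; ring.
by rewrite exprS -(subnSK km) (exprS (1 - p)) subnSK// (AC _ _ _ _ _ _ _ h).
Qed.

Lemma binomial_termS m k p : binomial_term m.+1 k.+1 p =
  (1 - p) * binomial_term m k.+1 p + p * binomial_term m k p.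
Proof.
rewrite /binomial_term binS natrD subSS.
have [km|mk|->] := ltngtP k m.
- by rewrite -(subnSK km) !exprS; ring.
- by rewrite (bin_small mk) (bin_small (leqW mk)); ring.
- by rewrite (bin_small (ltnSn m)) subnn exprS; ring.
Qed.

Lemma binomial_tail_total m p : binomial_tail m m.+1 p = 1.
Proof.
rewrite -[RHS](expr1n _ m) -[in RHS](subrK p 1) exprDn; apply: eq_bigr => k _.
by rewrite /binomial_term -mulr_natl; ring.
Qed.

Lemma binomial_tailS m r p :
  binomial_tail m r.+1 p - binomial_tail m.+1 r.+1 p = p * binomial_term m r p.
Proof.
elim: r => [|r IH].
  rewrite /binomial_tail !big_ord_recl !big_ord0 /binomial_term !bin0 !subn0.
  by rewrite !exprS; ring.
move: IH; rewrite /binomial_tail => IH.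
rewrite big_ord_recr [X in _ - X]big_ord_recr/= binomial_termS.
rewrite opprD addrACA IH; ring.
Qed.

(** The two tails are the probabilities of [N >= n] and of [N > n]; in this form the risk series can
    be summed by parts. *)
Lemma ibs_pmfE r p n : (0 < r <= n)%N ->
  ibs_pmf r p n = binomial_tail n.-1 r p - binomial_tail n r p.
Proof.
case: r => // r /andP[_]; case: n => // n rn; rewrite binomial_tailS.
by rewrite /ibs_pmf /binomial_term/= subSS exprS; ring.
Qed.

Lemma poisson_tail_le1 r x : 0 <= x -> poisson_tail r x <= 1.
Proof.
move=> x0; rewrite -(expRxMexpNx_1 x) /poisson_tail /poisson_term.
under eq_bigr do rewrite mulrAC.
rewrite -mulr_suml ler_wpM2r ?expR_ge0//.
rewrite -(big_mkord xpredT (fun k => x ^+ k / k`!%:R)).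
apply: (@nondecreasing_cvgn_le R (series (exp_coeff x)) _ _ r).
  apply/nondecreasing_seqP => n; rewrite /series/= big_nat_recr//= lerDl.
  exact: exp_coeff_ge0.
exact: is_cvg_series_exp_coeff.
Qed.

Lemma binomial_term_le_poisson n r p : (0 < r <= n)%N -> 0 < p < 1 ->
  r%:R <= (n%:R * p - r%:R) ^+ 2 ->
  binomial_term n r p <= poisson_term r (n%:R * p).
Proof.
move=> rn p01 H; have := ffact_poisson_le rn p01 H.
have [p0 _] := andP p01.
rewrite /poisson_term ler_pdivlMr; last by rewrite ltr0n fact_gt0.
have := congr1 (fun i => i%:R : R) (bin_ffact n r); rewrite natrM => <- h.
rewrite expRN ler_pdivlMr ?expR_gt0// exprMn.
have := ler_wpM2r (exprn_ge0 r (ltW p0)) h.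
by rewrite /binomial_term; congr (_ <= _); ring.
Qed.

Lemma binomial_term_le_poisson_pred n r p : (0 < r <= n)%N -> 0 < p < 1 ->
  r%:R <= (n%:R * p - r%:R) ^+ 2 ->
  binomial_term n.-1 r.-1 p <= poisson_term r.-1 (n%:R * p).
Proof.
move=> rn p01 H; have := ffact_poisson_le rn p01 H.
have [p0 _] := andP p01; have [r0 rn'] := andP rn.
have n0 : 0 < n%:R :> R by rewrite ltr0n (leq_trans r0).
rewrite /poisson_term ler_pdivlMr; last by rewrite ltr0n fact_gt0.
have : (n * ('C(n.-1, r.-1) * r.-1`!) = n ^_ r)%N.
  case: r n {H p01 n0} rn r0 rn' => // r [//|n] _ _ _.
  by rewrite bin_ffact ffactSS.
move=> /(congr1 (fun i => i%:R : R)); rewrite !natrM => <- h.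
rewrite expRN ler_pdivlMr ?expR_gt0// exprMn -(ler_pM2l n0).
have := ler_wpM2r (exprn_ge0 r.-1 (ltW p0)) h.
rewrite /binomial_term (_ : n%:R * (n%:R ^+ r.-1 * _) = n%:R ^+ r * p ^+ r.-1).
  have -> : (n.-1 - r.-1 = n - r)%N by case: r n r0 rn' {rn H n0 h} => // r [].
  by congr (_ <= _); ring.
by rewrite mulrA -exprS prednK.
Qed.

(** The domination at [r] spreads to every [k >= r], because the binomial ratio of consecutive terms
    is at most the Poisson one as soon as [n p <= k]. Complements reverse the inequality: the
    binomial terms sum exactly to [1], the Poisson terms up to [n] to at most [1]. *)
Lemma binomial_tail_ge_poisson n r p : (0 < r <= n)%N -> 0 < p < 1 ->
  n%:R * p <= r%:R -> r%:R <= (n%:R * p - r%:R) ^+ 2 ->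
  poisson_tail r (n%:R * p) <= binomial_tail n r p.
Proof.
move=> rn p01 npr H; have [p0 p1] := andP p01; have [r0 rn'] := andP rn.
have q0 : 0 < 1 - p by rewrite subr_gt0.
have np0 : 0 <= n%:R * p by rewrite mulr_ge0// ltW.
have n0 : 0 < n%:R :> R by rewrite ltr0n (leq_trans r0).
have term_le i : (r + i <= n)%N ->
    binomial_term n (r + i) p <= poisson_term (r + i) (n%:R * p).
  elim: i => [|i IH] rin; first by rewrite addn0; exact: binomial_term_le_poisson.
  rewrite addnS poisson_termS.
  have rin' : (r + i < n)%N by rewrite -addnS.
  have k0 : 0 < (r + i).+1%:R :> R by rewrite ltr0n.
  rewrite -(ler_pM2r (mulr_gt0 k0 q0)) binomial_term_step//.
  have -> : n%:R * p / (r + i).+1%:R * poisson_term (r + i) (n%:R * p) *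
     ((r + i).+1%:R * (1 - p)) = poisson_term (r + i) (n%:R * p) * (n%:R * p * (1 - p)).
    by field; apply: lt0r_neq0; move: k0; rewrite -natr1 natrD; lra.
  apply: ler_pM => //; [exact: binomial_term_ge0|by rewrite mulr_ge0// ltW|exact/IH/ltnW|].
  rewrite mulrAC ler_pM2r// natrB ?(ltnW rin')// natrD.
  have : 0 <= i%:R :> R by [].
  lra.
have : \sum_(r <= k < n.+1) binomial_term n k p <=
       \sum_(r <= k < n.+1) poisson_term k (n%:R * p).
  rewrite !big_nat; apply: ler_sum => k /andP[rk kn].
  by rewrite -(subnKC rk) term_le// subnKC.
have := binomial_tail_total n p; have := @poisson_tail_le1 n.+1 _ np0.
rewrite /poisson_tail /binomial_tail -!(big_mkord xpredT (poisson_term ^~ _))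
  -!(big_mkord xpredT (binomial_term n ^~ p)).
rewrite !(big_cat_nat (leq0n r) (leq_trans rn' (leqnSn n)))/=.
lra.
Qed.

(** The domination at [r.-1] spreads downwards: with [n.-1] trials the binomial ratio from [k] to
    [k.+1] is at least the Poisson one as soon as [k + 1 <= n p]. *)
Lemma binomial_tail_le_poisson n r p : (0 < r <= n)%N -> 0 < p < 1 ->
  r%:R <= n%:R * p -> r%:R <= (n%:R * p - r%:R) ^+ 2 ->
  binomial_tail n.-1 r p <= poisson_tail r (n%:R * p).
Proof.
move=> rn p01 npr H; have [p0 p1] := andP p01; have [r0 rn'] := andP rn.
have q0 : 0 < 1 - p by rewrite subr_gt0.
have n0 : 0 < n%:R :> R by rewrite ltr0n (leq_trans r0).
have np0 : 0 < n%:R * p by rewrite mulr_gt0.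
have term_le i : (i <= r.-1)%N ->
    binomial_term n.-1 (r.-1 - i) p <= poisson_term (r.-1 - i) (n%:R * p).
  elim: i => [|i IH] ir; first by rewrite subn0; exact: binomial_term_le_poisson_pred.
  have := IH (ltnW ir); rewrite -(subnSK ir); set k := (r.-1 - i.+1)%N.
  have kr : (k.+1 < r)%N by rewrite /k; lia.
  have kn : (k < n.-1)%N by lia.
  have k0 : 0 < k.+1%:R :> R by rewrite ltr0n.
  rewrite poisson_termS -(ler_pM2r (mulr_gt0 k0 q0)) binomial_term_step//.
  have -> : n%:R * p / k.+1%:R * poisson_term k (n%:R * p) *
     (k.+1%:R * (1 - p)) = poisson_term k (n%:R * p) * (n%:R * (1 - p) * p).
    by field; apply: lt0r_neq0; move: k0; rewrite -natr1; lra.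
  have nk0 : 0 < (n.-1 - k)%:R * p by rewrite mulr_gt0// ltr0n subn_gt0.
  move=> /le_trans h; rewrite -(ler_pM2r nk0); apply: h.
  rewrite ler_pM2l ?poisson_term_gt0// ler_pM2r//.
  rewrite -subn1 -subnDA add1n natrB ?(leq_trans kn (leq_pred n))//.
  have : (k.+1%:R : R) <= r%:R by rewrite ler_nat ltnW.
  lra.
rewrite /poisson_tail /binomial_tail; apply: ler_sum => k _.
have kr : (k <= r.-1)%N by have := ltn_ord k; lia.
by rewrite -(subKn kr) term_le// leq_subr.
Qed.

Lemma is_derive_poisson_term0 x :
  is_derive x 1 (poisson_term 0) (- poisson_term 0 x).
Proof.
have -> : poisson_term 0 = (fun x => expR (- x)).
  by apply/funext => y; rewrite /poisson_term expr0 mul1r fact0 divr1.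
by apply: is_derive_eq; rewrite /GRing.scale/=; ring.
Qed.

Lemma is_derive_poisson_termS k x :
  is_derive x 1 (poisson_term k.+1) (poisson_term k x - poisson_term k.+1 x).
Proof.
have dX : is_derive x 1 (fun y : R => y ^+ k.+1) (k.+1%:R * x ^+ k).
  have := @is_deriveX R R id k.+1 x 1 1 (is_derive_id _ _).
  rewrite /GRing.scale/= mulr1; congr is_derive.
  by apply/funext => y; rewrite fctE.
rewrite /poisson_term; apply: is_derive_eq; rewrite /GRing.scale/=.
have f0 : k`!%:R != 0 :> R by rewrite pnatr_eq0 -lt0n fact_gt0.
have k0 : k.+1%:R != 0 :> R by rewrite pnatr_eq0.
rewrite factS natrM; move: k0; set c : R := k.+1%:R => c0.
move: f0; move: (k`!%:R) => F f0; field.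
by rewrite f0/= addrC natr1.
Qed.

Lemma is_derive_poisson_tail r x :
  is_derive x 1 (poisson_tail r.+1) (- poisson_term r x).
Proof.
elim: r => [|r IH].
  have -> : poisson_tail 1 = poisson_term 0.
    by apply/funext => y; rewrite /poisson_tail big_ord1.
  exact: is_derive_poisson_term0.
have -> : poisson_tail r.+2 = poisson_tail r.+1 \+ poisson_term r.+1.
  by apply/funext => y; rewrite /poisson_tail big_ord_recr.
have := is_derive_poisson_termS r x => ?.
by apply: is_derive_eq; ring.
Qed.

End poisson_binomial_tails.

(** * Shifting a Poisson tail by [p] and comparing with the Gamma mixture *)

Section ibs_tails.
Context {R : realType}.
Implicit Types (n m k r : nat) (p x y z : R).

(* Tail at [x] of the mixture of the Gamma distributions with shape parameters
   [r] and [r.+1] and respective weights [1 - p] and [p]. *)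
Definition mixture_tail r p x : R := poisson_tail r x + p * poisson_term r x.

(** Log-concavity: the logarithm of [poisson_term r] lies below its tangent at [x], of slope
    [r / x - 1]. Concretely, [1 - y <= expR (- y)] with [y = z * p / x] is raised to the power
    [r]. *)
Lemma poisson_termB_le r p x z : 0 < p -> p < x -> 0 <= z <= 1 ->
  poisson_term r (x - z * p) <= poisson_term r x * expR (z * p * (1 - r%:R / x)).
Proof.
move=> p0 px /andP[z0 z1]; have x0 : 0 < x by exact: lt_trans px.
have zpx : z * p < x by rewrite (le_lt_trans _ px)// ler_piMl// ltW.
have -> : expR (z * p * (1 - r%:R / x)) = expR (z * p) * expR (- (z * p / x)) ^+ r.
  by rewrite -expRM_natl -expRD; congr expR; field; exact: lt0r_neq0.
have -> : poisson_term r (x - z * p) =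
    (x - z * p) ^+ r * (expR (- x) * expR (z * p)) / r`!%:R.
  by rewrite /poisson_term -expRD; congr (_ * expR _ / _); ring.
rewrite /poisson_term.
have -> : x ^+ r * expR (- x) / r`!%:R * (expR (z * p) * expR (- (z * p / x)) ^+ r) =
   (x * expR (- (z * p / x))) ^+ r * (expR (- x) * expR (z * p)) / r`!%:R.
  by rewrite exprMn; ring.
rewrite ler_pM2r ?invr_gt0 ?ltr0n ?fact_gt0// ler_pM2r ?mulr_gt0 ?expR_gt0//.
apply: lerXn2r; rewrite ?nnegrE; [by rewrite subr_ge0 ltW|by rewrite mulr_ge0 ?expR_ge0// ltW|].
have := ler_wpM2l (ltW x0) (expR_ge1Dx (- (z * p / x))); apply: le_trans.
by rewrite mulrDr mulr1 mulrN mulrCA divff ?mulr1// gt_eqF.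
Qed.

(** The shift adds the integral of [p * poisson_term r (x - t * p)] over [t] in [[0, 1]], at most
    [p * poisson_term r x * (expR z - 1) / z] by log-concavity. The mixture offers
    [p * poisson_term r x * x / r.+1]. The Padé bound reduces the comparison to
    [2 * r.+1 <= x * (2 - z)], and since [x * z <= x - r] this holds once [x >= r + 2]. *)
Lemma poisson_tailB_le r p x : 0 < p < 1 -> r.+2%:R <= x ->
  poisson_tail r.+1 (x - p) <= mixture_tail r.+1 p x.
Proof.
move=> /andP[p0 p1] rx.
have x0 : 0 < x by rewrite (lt_le_trans _ rx).
have px : p < x by rewrite (lt_le_trans p1)// (le_trans _ rx)// -natr1 lerDr.
pose z := p * (1 - r%:R / x).
have rx1 : r%:R / x < 1.
  by rewrite ltr_pdivrMr// mul1r (lt_le_trans _ rx)// ltr_nat.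
have z0 : 0 < z by rewrite mulr_gt0// subr_gt0.
have zp : z <= 1 - r%:R / x by rewrite ler_piMl ?(ltW p1)// subr_ge0 ltW.
have phi0 : 0 < poisson_term r x by exact: poisson_term_gt0.
(* Monotonicity of [W] replaces the integral: its derivative is [z * p] times the gap in
   [poisson_termB_le]. *)
pose W t := p * poisson_term r x * expR (t * z) - z * poisson_tail r.+1 (x - t * p).
have : W 0 <= W 1.
  pose dW t := z * p * (poisson_term r x * expR (t * z) - poisson_term r (x - t * p)).
  apply: (@is_derive_ge0_le _ _ dW 0 1 ler01) => t /andP[t0 t1].
    have := is_derive_poisson_tail r (x - t * p) => d1.
    have d2 : is_derive t 1 (fun t => x - t * p) (- p).
      by apply: is_derive_eq; rewrite /GRing.scale/=; ring.
    have d3 : is_derive t 1 (fun t => poisson_tail r.+1 (x - t * p))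
        (p * poisson_term r (x - t * p)).
      have := @is_derive1_comp R _ _ t _ _ d1 d2.
      by congr is_derive; rewrite /=; ring.
    have d4 : is_derive t 1 (fun t => expR (t * z)) (z * expR (t * z)).
      have d5 : is_derive t 1 (fun t => t * z) z.
        by apply: is_derive_eq; rewrite /GRing.scale/=; ring.
      have := @is_derive1_comp R _ _ t _ _ (is_derive_expR (t * z)) d5.
      by congr is_derive; rewrite /=; ring.
    by apply: is_derive_eq; rewrite /dW /GRing.scale/=; ring.
  apply: mulr_ge0; first exact: mulr_ge0 (ltW z0) (ltW p0).
  rewrite subr_ge0.
  have := @poisson_termB_le r p x t p0 px; rewrite t0 t1 => /(_ isT).
  by rewrite /z mulrA.
rewrite /W !mul0r !mul1r expR0 subr0 mulr1 /mixture_tail => h.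
rewrite -lerBlDl -(ler_pM2l z0) poisson_termS.
apply: (@le_trans _ _ (p * poisson_term r x * (expR z - 1))); first lra.
rewrite (_ : z * _ = p * poisson_term r x * (z * x / r.+1%:R)); last by ring.
rewrite (ler_pM2l (mulr_gt0 p0 phi0)).
have rx0 : 0 <= r%:R / x by rewrite divr_ge0// ltW.
have z2 : 0 < 2 - z by lra.
rewrite lerBlDr -(ler_pM2r z2) (le_trans (expR_pade (ltW z0)))//.
have r0 : 0 < r.+1%:R :> R by [].
rewrite -subr_ge0.
have -> : (z * x / r.+1%:R + 1) * (2 - z) - (2 + z) =
    z / r.+1%:R * (x * (2 - z) - 2 * r.+1%:R).
  by field; move: r0; rewrite -natr1 => /lt0r_neq0; rewrite addrC.
apply: mulr_ge0; first exact: divr_ge0 (ltW z0) (ltW r0).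
rewrite subr_ge0.
have : x * z <= x - r%:R.
  rewrite (_ : x - r%:R = x * (1 - r%:R / x)) ?ler_pM2l//.
  by field; exact: lt0r_neq0.
move: rx; rewrite -!natr1; lra.
Qed.

(** By the mean value theorem the shift adds [p * poisson_term r c], to be compared with the
    [p * poisson_term r x * x / r.+1] of the mixture. The term may decrease from [x] to [c], and the
    factor [x / r.+1 <= 1] absorbs this decrease. *)
Lemma poisson_tailB_ge r n p : 0 < p -> (r.+1 <= n)%N -> n%:R * p <= r%:R ->
  mixture_tail r.+1 p (n.+1%:R * p) <= poisson_tail r.+1 (n%:R * p).
Proof.
move=> p0 rn npr.
have n0 : 0 < n%:R :> R by rewrite ltr0n (leq_trans _ rn).
set x := n.+1%:R * p; have xE : x = n%:R * p + p by rewrite /x -natr1; ring.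
have x0 : 0 < x by rewrite /x mulr_gt0.
clearbody x.
have px : x - p <= x by lra.
have [||c] := @MVT_segment R (poisson_tail r.+1) (fun y => - poisson_term r y) _ _ px.
- by move=> y _; exact: is_derive_poisson_tail.
- apply: derivable_within_continuous => y _.
  by have := is_derive_poisson_tail r y; case.
rewrite in_itv/= => /andP[cl cr]; rewrite (_ : x - (x - p) = p); last by ring.
have -> : x - p = n%:R * p by lra.
move=> tailE; suff : x / r.+1%:R * poisson_term r x <= poisson_term r c.
  move=> /(ler_wpM2l (ltW p0)); rewrite /mixture_tail poisson_termS.
  move: (x / _ * _) (poisson_term r c) (poisson_tail _ _) (poisson_tail _ _) tailE => A B C D E; lra.
have c0 : 0 < c by rewrite (lt_le_trans _ cl)// xE addrK mulr_gt0.
pose t := (x - c) / p.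
have t0 : 0 <= t by rewrite divr_ge0 ?subr_ge0// ltW.
have t1 : t <= 1 by rewrite ler_pdivrMr// mul1r; lra.
have cE : c = x - t * p by rewrite /t divfK ?gt_eqF//; ring.
(* The key bound is [c / x >= expR (- (t / n))], which follows from [c * (1 + t / n) - x = p * t *
   (1 - t) / n]; raised to the power [r], it gives an exponent linear in [t]. *)
have : poisson_term r x * (1 + t * (p - r%:R / n%:R)) <= poisson_term r c.
  apply: (@le_trans _ _ (poisson_term r x * expR (t * (p - r%:R / n%:R)))).
    by rewrite ler_pM2l ?poisson_term_gt0// expR_ge1Dx.
  have -> : expR (t * (p - r%:R / n%:R)) = expR (t * p) * expR (- (t / n%:R)) ^+ r.
    by rewrite -expRM_natl -expRD; congr expR; field; exact: lt0r_neq0.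
  have -> : poisson_term r c = c ^+ r * (expR (t * p) * expR (- x)) / r`!%:R.
    by rewrite /poisson_term -expRD {2}cE; congr (_ * expR _ / _); ring.
  rewrite /poisson_term.
  have -> : x ^+ r * expR (- x) / r`!%:R * (expR (t * p) * expR (- (t / n%:R)) ^+ r) =
     (x * expR (- (t / n%:R))) ^+ r * (expR (t * p) * expR (- x)) / r`!%:R.
    by rewrite exprMn; ring.
  rewrite ler_pM2r ?invr_gt0 ?ltr0n ?fact_gt0// ler_pM2r ?mulr_gt0 ?expR_gt0//.
  apply: lerXn2r; rewrite ?nnegrE ?(ltW c0)//; first by rewrite mulr_ge0 ?expR_ge0// ltW.
  rewrite expRN ler_pdivrMr ?expR_gt0//.
  apply: (@le_trans _ _ (c * (1 + t / n%:R))); last first.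
    by rewrite ler_pM2l// expR_ge1Dx.
  rewrite cE xE -subr_ge0.
  have -> : (n%:R * p + p - t * p) * (1 + t / n%:R) - (n%:R * p + p) =
     p * (t * (1 - t) / n%:R) by field; exact: lt0r_neq0.
  by rewrite mulr_ge0 ?(ltW p0)// divr_ge0 ?(ltW n0)// mulr_ge0// subr_ge0.
apply: le_trans; rewrite mulrC ler_pM2l ?poisson_term_gt0//.
rewrite ler_pdivrMr//.
have r0 : 0 < r.+1%:R :> R by [].
have : t * ((r%:R - n%:R * p) / n%:R) <= (r%:R - n%:R * p) / r.+1%:R.
  apply: (@le_trans _ _ ((r%:R - n%:R * p) / n%:R)).
    by rewrite ler_piMl// divr_ge0 ?(ltW n0)// subr_ge0.
  by rewrite ler_wpM2l ?subr_ge0// lef_pV2 ?posrE// ler_nat.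
rewrite ler_pdivlMr//.
have -> : p - r%:R / n%:R = - ((r%:R - n%:R * p) / n%:R) by field; exact: lt0r_neq0.
have p1 : p <= 1.
  rewrite -(ler_pM2l n0) mulr1 (le_trans npr)// ler_nat.
  exact: leq_trans (leqnSn r) rn.
rewrite mulrN xE -natr1; move: (t * ((r%:R - n%:R * p) / n%:R)) => A.
lra.
Qed.

End ibs_tails.

(** * Tail comparison for [(N + 1) p], and integrals of the mixture density *)

Section mixture_density.
Context {R : realType}.
Implicit Types (n m k r : nat) (p x y z : R).
Local Notation mu := (@lebesgue_measure R).

(** With [x = (n + 1) p], the summand [1] of the threshold pays for [n p = x - p], so
    [n p >= r + sqrt r] and the squared deviation is at least [r]. The condition of
    [poisson_tailB_le] at shape [r] is [x >= r + 1]. *)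
Lemma ibs_tail_right r n p : (0 < r <= n)%N -> 0 < p < 1 ->
  r%:R + Num.sqrt r%:R + 1 <= n.+1%:R * p ->
  binomial_tail n.-1 r p <= mixture_tail r p (n.+1%:R * p).
Proof.
move=> rn p01 b; have [p0 p1] := andP p01; have [r0 _] := andP rn.
have xE : n%:R * p = n.+1%:R * p - p by rewrite -natr1; ring.
have s0 : 0 <= Num.sqrt r%:R :> R by exact: sqrtr_ge0.
have sE : Num.sqrt r%:R ^+ 2 = r%:R :> R by rewrite sqr_sqrtr.
apply: (@le_trans _ _ (poisson_tail r (n%:R * p))).
  apply: binomial_tail_le_poisson => //; first by rewrite xE; lra.
  rewrite -[leLHS]sE ler_sqr ?nnegrE//; rewrite xE; lra.
rewrite xE; case: r r0 b {rn s0 sE} => // r _ b.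
apply: poisson_tailB_le => //.
by have := sqrtr_ge0 (r.+1%:R : R); move: b; rewrite -!natr1; lra.
Qed.

(** Here [n p < x <= r - sqrt r] directly. In addition [sqrt r >= 1] gives [n p <= r - 1], as
    [poisson_tailB_ge] demands at shape [r]. *)
Lemma ibs_tail_left r n p : (0 < r <= n)%N -> 0 < p < 1 ->
  n.+1%:R * p <= r%:R - Num.sqrt r%:R ->
  mixture_tail r p (n.+1%:R * p) <= binomial_tail n r p.
Proof.
move=> rn p01 b; have [p0 p1] := andP p01; have [r0 rn'] := andP rn.
have xE : n%:R * p = n.+1%:R * p - p by rewrite -natr1; ring.
have sE : Num.sqrt r%:R ^+ 2 = r%:R :> R by rewrite sqr_sqrtr.
have s1 : 1 <= Num.sqrt r%:R :> R.
  by rewrite -[leLHS]sqrtr1 ler_sqrt ?ltr0n// ler1n.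
apply: (@le_trans _ _ (poisson_tail r (n%:R * p))); last first.
  apply: binomial_tail_ge_poisson => //; first by rewrite xE; lra.
  rewrite -sqrrN opprB -[leLHS]sE ler_sqr ?nnegrE//; rewrite xE; lra.
case: r r0 rn' b s1 {rn sE} => // r _ rn' b s1.
apply: poisson_tailB_ge => //.
by rewrite xE; move: b s1; rewrite -!natr1; lra.
Qed.

Definition mixture_density r p x : R := (1 - p) * phi r x + p * phi r.+1 x.

Lemma mixture_density_ge0 r p x : 0 <= p <= 1 -> 0 <= x -> 0 <= mixture_density r p x.
Proof.
move=> /andP[p0 p1] x0; rewrite /mixture_density !phiE.
by rewrite addr_ge0// mulr_ge0 ?poisson_term_ge0 ?subr_ge0.
Qed.

Lemma continuous_poisson_term k : continuous (@poisson_term R k).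
Proof.
move=> x; apply: differentiable_continuous; apply/derivable1_diffP.
case: k => [|k]; first by have := is_derive_poisson_term0 x; case.
by have := is_derive_poisson_termS k x; case.
Qed.

Lemma continuous_mixture_density r p : continuous (mixture_density r p).
Proof.
move=> x; apply: cvgD; apply: cvgM; try exact: cvg_cst;
  exact: continuous_poisson_term.
Qed.

Lemma is_derive_mixture_tail r p x :
  is_derive x 1 (mixture_tail r.+1 p) (- mixture_density r.+1 p x).
Proof.
have := is_derive_poisson_tail r x => d1.
have := is_derive_poisson_termS r x => d2.
by apply: is_derive_eq; rewrite /mixture_density !phiE /GRing.scale/=; ring.
Qed.

(** [expR x] dominates the term of degree [k.+1] of its own series, which bounds the quotient by
    [k.+1 / x]. *)
Lemma poisson_term_cvgy k : poisson_term k x @[x --> +oo] --> (0 : R).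
Proof.
apply: (@squeeze_cvgr _ _ _ _ (cst 0) (fun x => k.+1%:R / x)).
- near=> x; rewrite /= poisson_term_ge0//=.
  have x0 : 0 < x by near: x; exact: nbhs_pinfty_gt.
  have f0 m : 0 < m`!%:R :> R by rewrite ltr0n fact_gt0.
  rewrite /poisson_term expRN -mulrA -invfM ler_pdivrMr ?mulr_gt0 ?expR_gt0//.
  have : x ^+ k.+1 / (k.+1)`!%:R <= expR x.
    by rewrite (le_trans _ (expR_ge1Dxn k (ltW x0)))// lerDr.
  rewrite ler_pdivrMr// factS natrM exprS => h.
  rewrite mulrAC ler_pdivlMr// mulrC (le_trans h)//.
  by rewrite le_eqVlt; apply/orP; left; apply/eqP; ring.
- exact: cvg_cst.
- rewrite -[X in _ --> X](mulr0 k.+1%:R); apply: cvgM; first exact: cvg_cst.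
  by apply/(gtr0_cvgV0 (f:=id)); [exact: nbhs_pinfty_gt|exact: cvg_id].
Unshelve. all: by end_near. Qed.

Lemma mixture_tail_cvgy r p : mixture_tail r p x @[x --> +oo] --> (0 : R).
Proof.
have c0 : poisson_tail r x @[x --> +oo] --> (0 : R).
  elim: r => [|r IH].
    have -> : poisson_tail 0 = cst (0 : R).
      by apply/funext => y; rewrite /poisson_tail big_ord0.
    exact: cvg_cst.
  have -> : @poisson_tail R r.+1 = poisson_tail r \+ poisson_term r.
    by apply/funext => y; rewrite /poisson_tail big_ord_recr.
  by rewrite -[0](addr0 0); apply: cvgD => //; exact: poisson_term_cvgy.
rewrite -[X in _ --> X](addr0 0); apply: cvgD => //.
rewrite -[X in _ --> X](mulr0 p); apply: cvgM; first exact: cvg_cst.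
exact: poisson_term_cvgy.
Qed.

Lemma integral_mixture_density r p y : 0 <= p <= 1 -> 0 <= y ->
  (\int[mu]_(x in `[y, +oo[) (mixture_density r.+1 p x)%:E
   = (mixture_tail r.+1 p y)%:E)%E.
Proof.
move=> p01 y0.
have dF x : is_derive x 1 (fun x => - mixture_tail r.+1 p x) (mixture_density r.+1 p x).
  have := is_derive_mixture_tail r p x => d.
  by apply: is_derive_eq; rewrite opprK.
rewrite (@ge0_continuous_FTC2y _ _ (fun x => - mixture_tail r.+1 p x) _ 0).
- by rewrite sub0e EFinN oppeK.
- by move=> x yx; apply: mixture_density_ge0 => //; exact: le_trans yx.
- by apply: continuous_subspaceT => x; exact: continuous_mixture_density.
- by rewrite -oppr0; apply: cvgN; exact: mixture_tail_cvgy.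
- by move=> x _; have := dF x; case.
- have [/derivable1_diffP/differentiable_continuous cF _] := dF y.
  exact: cvg_at_right_filter cF.
- by move=> x _; have := dF x; case=> _; rewrite derive1E.
Qed.

Lemma integral_phi r y : 0 <= y ->
  (\int[mu]_(x in `[y, +oo[) (phi r.+1 x)%:E = (poisson_tail r.+1 y)%:E)%E.
Proof.
move=> y0; transitivity (mixture_tail r.+1 0 y)%:E; last first.
  by rewrite /mixture_tail mul0r addr0.
rewrite -integral_mixture_density ?lexx ?ler01//.
by apply: eq_integral => x _; rewrite /mixture_density subr0 mul0r addr0 mul1r.
Qed.

Lemma mixture_tail0 r p : mixture_tail r.+1 p 0 = 1.
Proof.
have term0 k : poisson_term k.+1 0 = 0 :> R by rewrite poisson_termS !mul0r.
rewrite /mixture_tail /poisson_tail big_ord_recl big1 => [|i _]; last exact: term0.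
by rewrite term0 mulr0 !addr0 /poisson_term expr0 oppr0 expR0 fact0 divr1 mulr1.
Qed.

End mixture_density.

(** * Nonnegative integrals of real-valued functions *)

Section half_line.
Context {R : realType}.
Local Notation mu := (@lebesgue_measure R).
Implicit Types (f g : R -> R) (D : set R).

Lemma ge0_integral_itv_split f (a m b : itv_bound R) :
  (a <= m)%O -> (m <= b)%O -> measurable_fun [set` Interval a b] f ->
  (forall x, x \in Interval a b -> 0 <= f x) ->
  (\int[mu]_(x in [set` Interval a b]) (f x)%:E =
   \int[mu]_(x in [set` Interval a m]) (f x)%:E +
   \int[mu]_(x in [set` Interval m b]) (f x)%:E)%E.
Proof.
move=> am mb mf f0; rewrite (itv_bndbnd_setU am mb) ge0_integral_setU//.
- by rewrite -(itv_bndbnd_setU am mb); exact/measurable_EFinP.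
- by move=> x; rewrite -(itv_bndbnd_setU am mb)/= lee_fin; exact: f0.
- apply/disj_setPS => x [/=]; rewrite !itv_boundlr => /andP[_ xm] /andP[mx _].
  by move: (le_trans xm mx); rewrite bnd_simp ltxx.
Qed.

Lemma ge0_le_integralR D f g : measurable D ->
  measurable_fun D f -> measurable_fun D g ->
  (forall x, D x -> 0 <= f x <= g x) ->
  (\int[mu]_(x in D) (f x)%:E <= \int[mu]_(x in D) (g x)%:E)%E.
Proof.
move=> mD mf mg fg; apply: ge0_le_integral => //.
- by move=> x /fg/andP[+ _]; rewrite lee_fin.
- exact/measurable_EFinP.
- exact/measurable_EFinP.
- by move=> x /fg/andP[_ +]; rewrite lee_fin.
Qed.

Lemma ge0_integralZlR D f c : measurable D -> measurable_fun D f ->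
  (forall x, D x -> 0 <= f x) -> 0 <= c ->
  (\int[mu]_(x in D) (c * f x)%:E = c%:E * \int[mu]_(x in D) (f x)%:E)%E.
Proof.
move=> mD mf f0 c0; rewrite -ge0_integralZl_EFin//.
exact/measurable_EFinP.
Qed.

Lemma ge0_integralDR D f g : measurable D -> measurable_fun D f ->
  measurable_fun D g -> (forall x, D x -> 0 <= f x) -> (forall x, D x -> 0 <= g x) ->
  (\int[mu]_(x in D) (f x + g x)%:E =
   \int[mu]_(x in D) (f x)%:E + \int[mu]_(x in D) (g x)%:E)%E.
Proof.
by move=> mD mf mg f0 g0; rewrite -ge0_integralD//; exact/measurable_EFinP.
Qed.

End half_line.

(** * Summation by parts against a density with comparable tails *)

Section stochastic_dominance.
Context {R : realType}.
Local Notation mu := (@lebesgue_measure R).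
Variables (a : nat) (B x : nat -> R) (psi Psi k : R -> R).
Hypothesis x_gt0 : forall n, 0 < x n.
Hypothesis x_nd : forall n, x n <= x n.+1.
Hypothesis B_ge0 : forall n, (a <= n)%N -> 0 <= B n.
Hypothesis psi_ge0 : forall y : R, 0 < y -> 0 <= psi y.
Hypothesis k_ge0 : forall y : R, 0 < y -> 0 <= k y.
Hypothesis mpsi : measurable_fun (`]0, +oo[ : set R) psi.
Hypothesis mk : measurable_fun (`]0, +oo[ : set R) k.
Hypothesis PsiE : forall y : R, 0 < y ->
  (\int[mu]_(z in `[y, +oo[) (psi z)%:E = (Psi y)%:E)%E.

Let mpsik : measurable_fun (`]0, +oo[ : set R) (fun y => psi y * k y).
Proof. exact: measurable_funM. Qed.

Let pos (J : interval R) y : [set` J] `<=` `]0, +oo[ -> y \in J -> 0 < y.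
Proof. by move=> J0 /J0/=; rewrite in_itv/= andbT. Qed.

Let integral_ge (J : interval R) (c v : R) : [set` J] `<=` `]0, +oo[ -> 0 <= c ->
  (forall y, y \in J -> c <= k y) ->
  (\int[mu]_(y in [set` J]) (psi y)%:E = v%:E)%E ->
  ((v * c)%:E <= \int[mu]_(y in [set` J]) (psi y * k y)%:E)%E.
Proof.
move=> J0 c0 ck vE; have mpsiJ := measurable_funS (measurable_itv _) J0 mpsi.
rewrite EFinM -vE muleC -ge0_integralZlR//; last first.
  by move=> y /(pos J0); exact: psi_ge0.
apply: ge0_le_integralR => //.
- exact: measurable_funM.
- exact: measurable_funS mpsik.
- move=> y Jy; have y0 := pos J0 Jy; rewrite mulr_ge0 ?psi_ge0//=.
  by rewrite mulrC ler_wpM2l ?psi_ge0// ck.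
Qed.

Let subD (y : R) (b : bool) : 0 < y -> [set` Interval (BSide b y) +oo%O] `<=` `]0, +oo[.
Proof.
by move=> y0 z/=; rewrite !in_itv/= !andbT => /lteifW; exact: lt_le_trans.
Qed.

Let psi_cell (y z : R) : 0 < y -> y <= z ->
  (\int[mu]_(t in `[y, z[) (psi t)%:E = (Psi y - Psi z)%:E)%E.
Proof.
move=> y0 yz; have z0 : 0 < z by exact: lt_le_trans yz.
have := @ge0_integral_itv_split _ psi (BLeft y) (BLeft z) +oo%O _ _ _ _.
rewrite !PsiE// => /(_ yz isT) h.
rewrite EFinB h ?addeK//; [exact: measurable_funS (subD y0) mpsi|].
by move=> t /(pos (subD y0)); exact: psi_ge0.
Qed.

(** Abel summation cell by cell, [k] being bounded below on [[x n, x n.+1[] by its value at the left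
    end. The tail comparison is assumed only where [k] is positive, since for the loss it is
    available only beyond a threshold. *)
Lemma nondecreasing_tail_le m : {in `]0, +oo[ &, nondecreasing_fun k} ->
  (forall n, (a <= n)%N -> 0 < k (x n) -> B n <= Psi (x n)) ->
  ((\sum_(a <= n < a + m) (B n - B n.+1) * k (x n))%:E <=
   \int[mu]_(y in `]0%R, +oo[) (psi y * k y)%:E)%E.
Proof.
move=> k_nd BPsi.
have kx n y : x n <= y -> k (x n) <= k y.
  move=> xy; apply: k_nd => //; rewrite in_itv/= andbT//.
  exact: lt_le_trans xy.
(* The extra term prices at [k (x a)] the surplus of the density beyond [x a] together with the
   discrete mass not yet summed. It makes the induction close, and it is nonnegative. *)
suff: ((\sum_(a <= n < a + m) (B n - B n.+1) * k (x n) +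
    (Psi (x a) - B a + B (a + m)%N) * k (x a))%:E <=
   \int[mu]_(y in `[x a, +oo[) (psi y * k y)%:E)%E.
  move=> h; have : (\int[mu]_(y in `[x a, +oo[) (psi y * k y)%:E <=
    \int[mu]_(y in `]0%R, +oo[) (psi y * k y)%:E)%E.
    apply: ge0_subset_integral => //; first exact/measurable_EFinP.
      move=> y /=; rewrite in_itv/= andbT => y0.
      by rewrite lee_fin mulr_ge0 ?psi_ge0 ?k_ge0.
    exact: subD.
  apply: le_trans; apply: le_trans h; rewrite lee_fin lerDl.
  have := k_ge0 (x_gt0 a); rewrite le_eqVlt => /orP[/eqP <-|ka]; first by rewrite mulr0.
  rewrite mulr_ge0 ?(ltW ka)// addr_ge0 ?B_ge0 ?leq_addr// subr_ge0; exact: BPsi.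
have BPsi' : forall i, (Psi (x (a + i)%N) - B (a + i)%N) * 0 <= 0 by move=> i; rewrite mulr0.
(* The induction removes the first cell, so the starting index has to vary. *)
move: (a) B_ge0 BPsi (BPsi') => a' B0 {}BPsi _.
elim: m a' B0 BPsi => [|m IH] a' B0 BPsi.
  rewrite addn0 big_geq// add0r subrK; apply: integral_ge; first exact: subD.
  - by apply: k_ge0; exact: x_gt0.
  - by move=> y; rewrite in_itv/= andbT; exact: kx.
  - exact: PsiE.
have := IH a'.+1 (fun n an => B0 n (ltnW an)) (fun n an => BPsi n (ltnW an)).
rewrite addSnnS => {}IH.
rewrite (@ge0_integral_itv_split _ _ (BLeft (x a')) (BLeft (x a'.+1)))//; last 3 first.
- by rewrite bnd_simp.
- exact: measurable_funS (subD (x_gt0 a')) mpsik.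
- move=> y /(pos (subD (x_gt0 a'))) y0; rewrite mulr_ge0 ?psi_ge0 ?k_ge0//.
have cell : (((Psi (x a') - Psi (x a'.+1)) * k (x a'))%:E <=
    \int[mu]_(y in `[x a', x a'.+1[) (psi y * k y)%:E)%E.
  apply: integral_ge.
  - apply: subset_trans (@subD _ true (x_gt0 a')) => y /=.
    by rewrite !in_itv/= => /andP[-> _].
  - by apply: k_ge0; exact: x_gt0.
  - by move=> y; rewrite in_itv/= => /andP[+ _]; exact: kx.
  - exact: psi_cell.
apply: le_trans (leeD cell IH); rewrite -EFinD lee_fin.
rewrite big_ltn; last by rewrite addnS ltnS leq_addr.
(* This is the slack of the step. Where [k] vanishes at [x a'.+1] no tail comparison is available,
   but then the increment of [k] vanishes as well. *)
have : 0 <= (Psi (x a'.+1) - B a'.+1 + B (a' + m.+1)%N) * (k (x a'.+1) - k (x a')).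
  have kk : k (x a') <= k (x a'.+1) by exact: kx.
  have := k_ge0 (x_gt0 a'.+1); rewrite le_eqVlt => /orP[/eqP k0|ka].
    have -> : k (x a') = 0 by apply/eqP; rewrite eq_le k_ge0// andbT k0.
    by rewrite -k0 subrr mulr0.
  rewrite mulr_ge0 ?subr_ge0// addr_ge0 ?B0 ?leq_addr// subr_ge0.
  exact: BPsi.
move: (\sum_(_ <= n < _) _) => S.
lra.
Qed.

Hypothesis B_noninc : forall n, (a <= n)%N -> B n.+1 <= B n.
Hypothesis psi1 : (\int[mu]_(z in `]0%R, +oo[) (psi z)%:E = (B a)%:E)%E.

(** For nonincreasing [k] the discrete law must lie to the right of the density, so the strict tail
    [B n.+1] at [x n] has to dominate [Psi (x n)]. The integral is built up from [0], each cell
    priced at its right end, and [psi1] equates the total masses. *)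
Lemma nonincreasing_tail_le m : {in `]0, +oo[ &, nonincreasing_fun k} ->
  (forall n, (a <= n)%N -> 0 < k (x n) -> Psi (x n) <= B n.+1) ->
  ((\sum_(a <= n < a + m) (B n - B n.+1) * k (x n))%:E <=
   \int[mu]_(y in `]0%R, +oo[) (psi y * k y)%:E)%E.
Proof.
move=> k_ni BPsi.
have kx n y : 0 < y -> y <= x n -> k (x n) <= k y.
  by move=> y0 xy; apply: k_ni; rewrite // in_itv/= andbT.
have sub0 (y : R) : `]0, y[ `<=` `]0, +oo[.
  by move=> z/=; rewrite !in_itv/= andbT => /andP[].
(* Here the extra term sits at the moving right end: the surplus of the discrete tail over the
   continuous one, priced at the current value of [k]. *)
suff: ((\sum_(a <= n < a + m) (B n - B n.+1) * k (x n) +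
    (B (a + m)%N - Psi (x (a + m)%N)) * k (x (a + m)%N))%:E <=
   \int[mu]_(y in `]0%R, x (a + m)%N[) (psi y * k y)%:E)%E.
  move=> h; have : (\int[mu]_(y in `]0%R, x (a + m)%N[) (psi y * k y)%:E <=
    \int[mu]_(y in `]0%R, +oo[) (psi y * k y)%:E)%E.
    apply: ge0_subset_integral => //; first exact/measurable_EFinP.
    move=> y /=; rewrite in_itv/= andbT => y0.
    by rewrite lee_fin mulr_ge0 ?psi_ge0 ?k_ge0.
  apply: le_trans; apply: le_trans h; rewrite lee_fin lerDl.
  have := k_ge0 (x_gt0 (a + m)); rewrite le_eqVlt => /orP[/eqP <-|ka]; first by rewrite mulr0.
  rewrite mulr_ge0 ?(ltW ka)// subr_ge0 (le_trans (BPsi _ _ ka)) ?leq_addr//.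
  by apply: B_noninc; rewrite leq_addr.
elim: m => [|m IH].
  rewrite addn0 big_geq// add0r; apply: integral_ge => //.
  - by apply: k_ge0; exact: x_gt0.
  - by move=> y; rewrite in_itv/= => /andP[y0 /ltW]; exact: kx.
  - have := @ge0_integral_itv_split _ psi (BRight 0) (BLeft (x a)) +oo%O _ _ _ _.
    rewrite PsiE// psi1 => h; rewrite EFinB h ?addeK//.
    + by rewrite bnd_simp.
    + by move=> t; rewrite in_itv/= andbT; exact: psi_ge0.
rewrite addnS big_nat_recr ?leq_addr//=; set n := (a + m)%N in IH *.
rewrite (@ge0_integral_itv_split _ _ (BRight 0) (BLeft (x n)))//; last 4 first.
- by rewrite bnd_simp.
- by rewrite bnd_simp.
- exact: measurable_funS (sub0 _) mpsik.
- by move=> y /(pos (@sub0 _)) y0; rewrite mulr_ge0 ?psi_ge0 ?k_ge0.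
have cell : (((Psi (x n) - Psi (x n.+1)) * k (x n.+1))%:E <=
    \int[mu]_(y in `[x n, x n.+1[) (psi y * k y)%:E)%E.
  apply: integral_ge.
  - apply: subset_trans (@subD _ true (x_gt0 n)) => y /=.
    by rewrite !in_itv/= => /andP[-> _].
  - by apply: k_ge0; exact: x_gt0.
  - move=> y; rewrite in_itv/= => /andP[ny /ltW yn]; apply: kx => //.
    exact: lt_le_trans ny.
  - exact: psi_cell.
apply: le_trans (leeD IH cell); rewrite -EFinD lee_fin.
have : 0 <= (B n.+1 - Psi (x n)) * (k (x n) - k (x n.+1)).
  have kk : k (x n.+1) <= k (x n) by exact: kx.
  have := k_ge0 (x_gt0 n); rewrite le_eqVlt => /orP[/eqP k0|ka].
    have -> : k (x n.+1) = 0 by apply/eqP; rewrite eq_le k_ge0// andbT k0.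
    by rewrite -k0 subrr mulr0.
  rewrite mulr_ge0 ?subr_ge0//; apply: BPsi => //; exact: leq_addr.
move: (\sum_(_ <= n < _) _) => S.
lra.
Qed.

End stochastic_dominance.

(** * Measurability of monotone functions and linear change of variable *)

Section measurability_scaling.
Context {R : realType}.
Local Notation mu := (@lebesgue_measure R).
Implicit Types (f g L : R -> R) (c v x y : R).

Lemma measurable_fun_nondecreasing_itv (I : interval R) f :
  {in I &, nondecreasing_fun f} -> measurable_fun [set` I] f.
Proof.
move=> f_nd; apply: (measurability (@RGenCInfty.G R)) => [|/= _ [_] [r] -> <-].
  exact: RGenCInfty.measurableE.
apply: is_interval_measurable => s t/= [Is fs] [It ft] u /andP[su ut].
have Iu : u \in I by apply: (@interval_is_interval _ I s t Is It u); rewrite su ut.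
split => //=; move: fs; rewrite !in_itv/= !andbT => /le_trans; apply.
exact: f_nd.
Qed.

Lemma measurable_fun_nonincreasing_itv (I : interval R) f :
  {in I &, nonincreasing_fun f} -> measurable_fun [set` I] f.
Proof.
move=> f_ni; rewrite -(opprK f); apply/measurable_funN.
by apply: measurable_fun_nondecreasing_itv => s t Is It st; rewrite lerN2 f_ni.
Qed.

(** Lebesgue measure is the image, under multiplication by [c], of [c] times itself; uniqueness on
    half-open intervals proves it, so [f] need only be measurable. *)
Lemma ge0_integral_scale c f : 0 < c ->
  measurable_fun (`]0, +oo[ : set R) f -> (forall x, 0 < x -> 0 <= f x) ->
  (\int[mu]_(x in `]0%R, +oo[) (f x)%:E =
   \int[mu]_(x in `]0%R, +oo[) (c * f (c * x))%:E)%E.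
Proof.
move=> c0 mf f0.
have mphi : measurable_fun setT ( *%R c : R -> measurableTypeR R).
  exact: mulrl_measurable.
have preD : ( *%R c : R -> measurableTypeR R) @^-1` `]0, +oo[%classic = `]0, +oo[%classic.
  by apply/seteqP; split => x /=; rewrite !in_itv/= !andbT pmulr_rgt0.
have D0 (x : R) : x \in `]0, +oo[ -> 0 < x by rewrite in_itv/= andbT.
have mfc : measurable_fun (`]0, +oo[ : set R) (fun x => f (c * x)).
  apply: (measurable_comp (measurable_itv `]0, +oo[)) mf _.
    by move=> _ [x xD <-]; move: xD; rewrite -[X in X x]preD.
  exact: measurable_funS mphi.
rewrite ge0_integralZlR ?(ltW c0)//; last by move=> x /D0 x0; rewrite f0// mulr_gt0.
pose phi : R -> measurableTypeR R := *%R c.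
pose phi_pack : {mfun _ >-> _} := HB.pack phi (isMeasurableFun.Build _ _ _ _ _ mphi).
transitivity (\int[pushforward (mscale (NngNum (ltW c0)) mu) phi_pack]_(x in `]0%R, +oo[)
   (f x)%:E)%E.
  apply: eq_measure_integral => A mA _; apply: lebesgue_measure_unique => //.
  move=> X /ocitvP[->|[[a b] /= ab ->]]; first by rewrite !measure0.
  rewrite /pushforward /mscale/=.
  have -> : phi @^-1` `]a, b]%classic = `]a / c, b / c]%classic.
    apply/seteqP; split => x /=; rewrite !in_itv/= /phi.
      by rewrite ltr_pdivrMr// ler_pdivlMr// mulrC.
    by rewrite ltr_pdivrMr// ler_pdivlMr// (mulrC x).
  rewrite !lebesgue_measure_itv/= !lte_fin ab ltr_pM2r ?invr_gt0// ab.
  rewrite -!EFinB -EFinM; congr EFin; field; exact: lt0r_neq0.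
rewrite ge0_integral_pushforward//.
- rewrite preD ge0_integral_mscale//.
  + exact/measurable_EFinP.
  + by move=> x /D0 x0; rewrite /= lee_fin f0// mulr_gt0.
- exact/measurable_EFinP.
- by move=> y; rewrite inE => /D0 y0; rewrite lee_fin f0.
Qed.

End measurability_scaling.

(** * Losses with a single turning point [v] *)

Section unimodal_loss.
Context {R : realType}.
Local Notation mu := (@lebesgue_measure R).
Variables (L : R -> R) (v : R).
Hypothesis L_ge0 : forall x : R, 0 < x -> 0 <= L x.
Hypothesis v_gt0 : 0 < v.
Hypothesis L_ni : {in `]0, v] &, nonincreasing_fun L}.
Hypothesis L_nd : {in `[v, +oo[ &, nondecreasing_fun L}.

Lemma measurable_loss : measurable_fun (`]0, +oo[ : set R) L.
Proof.
have -> : (`]0, +oo[%classic : set R) = `]0, v]%classic `|` `[v, +oo[%classic.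
  apply/seteqP; split=> x /=; rewrite !in_itv/= !andbT.
    by move=> ->; case: (leP x v) => [|/ltW]; [left|right].
  by case=> [/andP[]//|]; exact: lt_le_trans.
apply/measurable_funU => //; split.
  exact: measurable_fun_nonincreasing_itv.
exact: measurable_fun_nondecreasing_itv.
Qed.

Lemma loss_min (x : R) : 0 < x -> L v <= L x.
Proof.
move=> x0; have [xv|/ltW vx] := leP x v.
  by apply: L_ni => //; rewrite in_itv/= ?x0 ?v_gt0 ?lexx.
by apply: L_nd => //; rewrite in_itv/= ?lexx ?vx.
Qed.

Lemma loss_le_ends (x1 x2 x : R) : 0 < x1 -> x1 <= x <= x2 -> L x <= L x1 + L x2.
Proof.
move=> x10 /andP[x1x xx2]; have x0 := lt_le_trans x10 x1x.
have x20 := lt_le_trans x0 xx2.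
have [xv|/ltW vx] := leP x v.
  have : L x <= L x1.
    apply: L_ni => //; rewrite in_itv/= ?x0 ?x10 ?xv//.
    exact: le_trans xv.
  by move/le_trans; apply; rewrite lerDl L_ge0.
have : L x <= L x2.
  apply: L_nd => //; rewrite in_itv/= andbT//.
  exact: le_trans xx2.
by move/le_trans; apply; rewrite lerDr L_ge0.
Qed.

Lemma measurable_loss_div (c : R) : 0 < c ->
  measurable_fun (`]0, +oo[ : set R) (fun x => L (c / x)).
Proof.
move=> c0; apply: (measurable_comp (measurable_itv `]0, +oo[)) measurable_loss _.
  by move=> _ [x + <-]; rewrite /= !in_itv/= !andbT => x0; rewrite divr_gt0.
apply: open_continuous_measurable_fun => //.
move=> x; rewrite inE/= in_itv/= andbT => x0.
apply: cvgM; first exact: cvg_cst.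
by apply: cvgV; [exact: lt0r_neq0|exact: cvg_id].
Qed.

Lemma measurable_phi r (D : set R) : measurable D -> measurable_fun D (phi r).
Proof.
move=> mD; apply: measurable_funTS; apply: continuous_measurable_fun.
exact: continuous_poisson_term.
Qed.

Lemma phi_ge0 r (x : R) : 0 < x -> 0 <= phi r x :> R.
Proof. by move=> /ltW; rewrite phiE; exact: poisson_term_ge0. Qed.

(** The substitution [nu = s * u] moves the scale from the loss, which may jump, to the density,
    which is smooth; comparisons between scales go through this identity. *)
Lemma asym_risk_scale r (s c : R) : 0 < s -> 0 < c ->
  (asym_risk r L (s * c) =
   \int[mu]_(u in `]0%R, +oo[) (s * phi r (s * u) * L (c / u))%:E)%E.
Proof.
move=> s0 c0; rewrite /asym_risk (ge0_integral_scale s0).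
- apply: eq_integral => u; rewrite inE/= in_itv/= andbT => u0.
  rewrite mulrA; congr ((_ * L _)%:E); field.
  by rewrite !lt0r_neq0.
- apply: measurable_funM; first exact: measurable_phi.
  by apply: measurable_loss_div; rewrite mulr_gt0.
- by move=> x x0; rewrite mulr_ge0 ?phi_ge0// L_ge0// divr_gt0// mulr_gt0.
Qed.

End unimodal_loss.

(** * Finiteness of the asymptotic risk *)

Section finite_risk.
Context {R : realType}.
Local Notation mu := (@lebesgue_measure R).
Implicit Types (g a : R).

Lemma integral_powR_lty g a : 0 < g -> 0 < a ->
  (\int[mu]_(x in `]0%R, a[) (x `^ (g - 1))%:E < +oo)%E.
Proof.
move=> g0 a0.
have cpow h : {in `]0, +oo[, continuous (fun x : R => x `^ h)}.
  move=> x; rewrite in_itv/= andbT => x0; apply: differentiable_continuous.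
  by apply/derivable1_diffP; have := is_derive1_powR h x0; case.
have mpow (D : set R) : measurable D -> D `<=` `]0, +oo[ ->
    measurable_fun D (fun x : R => (x `^ (g - 1))%:E).
  move=> mD D0; apply/measurable_EFinP; apply: measurable_funS D0 _ => //.
  apply: open_continuous_measurable_fun => // x; rewrite inE; exact: cpow.
(* An exhaustion of []0, a]]; [n.+2] rather than [n.+1] keeps the first interval nondegenerate for
   the fundamental theorem of calculus. *)
pose F n : set R := `[a / n.+2%:R, a]%classic.
have F0 n : F n `<=` `]0, +oo[.
  move=> x; rewrite /F/= !in_itv/= andbT => /andP[+ _].
  by apply: lt_le_trans; rewrite divr_gt0.
have Fint n : (\int[mu]_(x in F n) (x `^ (g - 1))%:E <= (a `^ g / g)%:E)%E.
  pose b := a / n.+2%:R; have b0 : 0 < b by rewrite divr_gt0.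
  have ba : b < a by rewrite ltr_pdivrMr// ltr_pMr// ltr1n.
  rewrite (@continuous_FTC2 _ _ (fun x => x `^ g / g)) //.
  - by rewrite -EFinB lee_fin gerBl divr_ge0 ?powR_ge0// ltW.
  - apply: continuous_in_subspaceT => x; rewrite inE => /(F0 n).
    exact: cpow.
  - have d (x : R) : 0 < x -> derivable (fun x => x `^ g / g) x 1.
      move=> x0; have := is_derive1_powR g x0 => ?.
      by apply: derivableM => //; case: (is_derive1_powR g x0).
    split.
    + by move=> x; rewrite in_itv/= => /andP[bx _]; apply: d; exact: lt_trans bx.
    + have /derivable1_diffP/differentiable_continuous c := d _ b0.
      exact: cvg_at_right_filter c.
    + have /derivable1_diffP/differentiable_continuous c := d _ a0.
      exact: cvg_at_left_filter c.
  - move=> x; rewrite in_itv/= => /andP[bx _].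
    have x0 : 0 < x by exact: lt_trans bx.
    have d := is_derive1_powR g x0; rewrite derive1E.
    have d' : is_derive x 1 (fun x => x `^ g / g) (x `^ (g - 1)).
      by apply: is_derive_eq; rewrite /GRing.scale/=; field; exact: lt0r_neq0.
    by case: d'.
have FU : \bigcup_n F n = `]0, a]%classic.
  apply/seteqP; split => x.
    move=> [n _ Fx]; have := F0 n x Fx; move: Fx; rewrite /F/= !in_itv/= andbT.
    by move=> /andP[_ ->] ->.
  rewrite /= in_itv/= => /andP[x0 xa]; have [n an] := ltr_add_invr x0.
  pose k := Num.truncn (a / x); exists k => //; rewrite /F/= in_itv/= xa andbT.
  rewrite ler_pdivrMr// mulrC -ler_pdivrMr// (le_trans (ltW (truncnS_gt _)))//.
  by rewrite ler_nat.
have nF : nondecreasing_seq F.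
  move=> m n mn; apply/subsetPset => x; rewrite /F/= !in_itv/= => /andP[+ ->].
  rewrite andbT; apply: le_trans; rewrite ler_pM2l// lef_pV2 ?posrE//.
  by rewrite ler_nat !ltnS.
have cF : ((\int[mu]_(x in F n) (x `^ (g - 1))%:E) @[n --> \oo] -->
    \int[mu]_(x in \bigcup_n F n) (x `^ (g - 1))%:E)%E.
  apply: ge0_nondecreasing_set_cvg_integral => //.
  - by move=> n; exact: measurable_itv.
  - by move=> n; apply: mpow => //; exact: measurable_itv.
  - by move=> n x _; rewrite lee_fin powR_ge0.
apply: (@le_lt_trans _ _ (a `^ g / g)%:E); last exact: ltry.
apply: (@le_trans _ _ (\int[mu]_(x in `]0%R, a]) (x `^ (g - 1))%:E)%E).
  apply: ge0_subset_integral => //.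
  - by apply: mpow => // x /=; rewrite !in_itv/= andbT => /andP[].
  - by move=> x _; rewrite lee_fin powR_ge0.
  - by move=> x/=; rewrite !in_itv/= => /andP[-> /ltW].
rewrite -FU -(cvg_lim (@ereal_hausdorff R) cF).
apply: lime_le; last exact: nearW.
by apply/cvg_ex; eexists; exact: cF.
Qed.

Lemma phi_mul_exp r m (x : R) :
  phi r.+1 x * x ^+ m = (r + m)`!%:R / r`!%:R * phi (r + m).+1 x.
Proof.
rewrite /phi/= exprD; field.
by rewrite !pnatr_eq0 -!lt0n !fact_gt0.
Qed.

Lemma expRN_le_taylor2 (z : R) : 0 <= z -> expR (- z) <= 1 - z + z ^+ 2 / 2.
Proof.
move=> z0; rewrite -subr_ge0.
pose f t : R := 1 - t + t ^+ 2 / 2 - expR (- t).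
suff : f 0 <= f z by rewrite /f oppr0 expR0; lra.
apply: (@is_derive_ge0_le _ _ (fun t => expR (- t) - (1 - t))) => // t _.
  by apply: is_derive_eq; rewrite /GRing.scale/=; field.
by rewrite subr_ge0; have := expR_ge1Dx (- t).
Qed.

Section first_order.
Variables (L : R -> R) (v : R).
Hypothesis L_ge0 : forall x : R, 0 < x -> 0 <= L x.
Hypothesis v_gt0 : 0 < v.
Hypothesis L_ni : {in `]0, v] &, nonincreasing_fun L}.
Hypothesis L_nd : {in `[v, +oo[ &, nondecreasing_fun L}.

Let mL := @measurable_loss_div _ _ _ v_gt0 L_ni L_nd.

(** The argument [c / u] exchanges the ends: growth of [L] at infinity meets [u ^+ r] near [0],
    integrable since [K' < r.+1], and growth at [0] meets exponential decay. In between, unimodality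
    bounds [L] by two end values. *)
Lemma asym_risk_lty r (c : R) : 0 < c ->
  (exists K : R, Theta_at0 L (fun x => x `^ K)) ->
  (exists2 K' : R, K' < r.+1%:R & Theta_aty L (fun x => x `^ K')) ->
  (asym_risk r.+1 L c < +oo)%E.
Proof.
move=> c0 [K [a0 [m0 [M0 [a00 _ M00 LM0]]]]] [K' K'r [a1 [m1 [M1 [a10 _ M10 LM1]]]]].
(* Below [al], [c / u] is in the range of the estimate at infinity; beyond [be] it is in the range
   of the estimate at [0]. Taking [be >= 1] lets the power [- K] be replaced by a larger natural
   one. *)
pose al := c / a1; have al0 : 0 < al by exact: divr_gt0.
pose be := Num.max (Num.max 1 al) (c / a0).
have be1 : 1 <= be by rewrite !le_max lexx.
have be0 : 0 < be by exact: lt_le_trans be1.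
have albe : al <= be by rewrite !le_max lexx orbT.
have cbe : c / a0 <= be by rewrite le_max lexx orbT.
have mphi k D : measurable D -> measurable_fun D (@phi R k) by exact: measurable_phi.
have powE h x : 0 < x -> (c / x) `^ h = c `^ h * x `^ (- h).
  move=> x0; rewrite powRM ?invr_ge0 ?(ltW c0) ?(ltW x0)//.
  by rewrite -(powR_inv1 (ltW x0)) -powRrM mulN1r.
have Lc_ge0 x : 0 < x -> 0 <= L (c / x) by move=> x0; rewrite L_ge0// divr_gt0.
have mf : measurable_fun (`]0, +oo[ : set R) (fun x => phi r.+1 x * L (c / x)).
  by apply: measurable_funM; [exact: mphi|exact: mL].
have f0 x : 0 < x -> 0 <= phi r.+1 x * L (c / x).
  by move=> x0; rewrite mulr_ge0 ?phi_ge0// Lc_ge0.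
rewrite /asym_risk (@ge0_integral_itv_split _ _ _ (BLeft al))//; last first.
  by move=> x; rewrite in_itv/= andbT; exact: f0.
apply: lte_add_pinfty.
- pose g := r.+1%:R - K'; have g0 : 0 < g by rewrite subr_gt0.
  pose C := M1 * c `^ K'; have C0 : 0 <= C by rewrite mulr_ge0 ?powR_ge0// ltW.
  apply: (@le_lt_trans _ _ (C%:E * \int[mu]_(x in `]0%R, al[) (x `^ (g - 1))%:E)%E); last first.
    by rewrite lte_mul_pinfty ?lee_fin// integral_powR_lty.
  have mpow : measurable_fun (`]0, al[ : set R) (fun x : R => x `^ (g - 1)).
    apply: open_continuous_measurable_fun => // x; rewrite inE/= in_itv/= => /andP[x0 _].
    apply: differentiable_continuous; apply/derivable1_diffP.
    by have := is_derive1_powR (g - 1) x0; case.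
  rewrite -ge0_integralZlR//; last by move=> x _; exact: powR_ge0.
  apply: ge0_le_integralR => //.
  + by apply: measurable_funS mf => // x; rewrite /= !in_itv/= andbT => /andP[].
  + exact: measurable_funM.
  + move=> x; rewrite /= in_itv/= => /andP[x0 xal]; rewrite f0//=.
    have a1x : a1 <= c / x by rewrite ler_pdivlMr// mulrC -ler_pdivlMr// ltW.
    have /andP[_] := LM1 _ a1x; rewrite powE// mulrA -/C => Lx.
    have px : phi r.+1 x <= x ^+ r.
      rewrite /phi/= ler_pdivrMr ?ltr0n ?fact_gt0//.
      rewrite ler_pM ?exprn_ge0 ?expR_ge0 ?(ltW x0)//.
      rewrite (@le_trans _ _ 1)//; first by rewrite expR_le1 oppr_le0 ltW.
      by rewrite ler1n fact_gt0.
    apply: (@le_trans _ _ (x ^+ r * (C * x `^ (- K')))).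
      by apply: ler_pM => //; [exact: phi_ge0|exact: Lc_ge0].
    rewrite mulrCA ler_wpM2l// -powR_mulrn ?(ltW x0)// -powRD ?(gt_eqF x0) ?implybT//.
    by rewrite /g -natr1 le_eqVlt; apply/orP; left; apply/eqP; congr (_ `^ _); ring.
(* A natural power [m] of the variable raises the Gamma shape to [(r + m).+1], whose integral is
   finite. *)
- have [m Km] : exists m : nat, - K <= m%:R.
    by exists (Num.truncn (- K)).+1; exact/ltW/truncnS_gt.
  pose C2 := L (c / be) + L (c / al).
  have C20 : 0 <= C2 by rewrite addr_ge0// Lc_ge0.
  pose C3 := M0 * c `^ K * ((r + m)`!%:R / r`!%:R).
  have C30 : 0 <= C3 by rewrite !mulr_ge0 ?powR_ge0 ?invr_ge0// ltW.
  have alx x : x \in `[al, +oo[ -> 0 < x.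
    by rewrite in_itv/= andbT; exact: lt_le_trans.
  apply: (@le_lt_trans _ _ (\int[mu]_(x in `[al, +oo[)
      (C2 * phi r.+1 x + C3 * phi (r + m).+1 x)%:E)%E); last first.
    rewrite ge0_integralDR//.
    + rewrite !ge0_integralZlR//; try exact: mphi.
      * by apply: lte_add_pinfty; rewrite lte_mul_pinfty ?lee_fin//
          integral_phi ?(ltW al0)// ltry.
      * by move=> x /alx; exact: phi_ge0.
      * by move=> x /alx; exact: phi_ge0.
    + by apply: measurable_funM => //; exact: mphi.
    + by apply: measurable_funM => //; exact: mphi.
    + by move=> x /alx x0; rewrite mulr_ge0 ?phi_ge0.
    + by move=> x /alx x0; rewrite mulr_ge0 ?phi_ge0.
  apply: ge0_le_integralR => //.
  + by apply: measurable_funS mf => // x /alx; rewrite /= in_itv/= andbT.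
  + by apply: measurable_funD; apply: measurable_funM => //; exact: mphi.
  + move=> x xal; have x0 := alx x xal; move: xal; rewrite /= in_itv/= andbT => xal.
    rewrite f0//=; have [xbe|bex] := leP x be.
      apply: ler_wpDr; first by rewrite mulr_ge0 ?phi_ge0.
      rewrite mulrC ler_wpM2r ?phi_ge0//.
      apply: (@loss_le_ends _ L v); rewrite ?divr_gt0//.
      by rewrite !ler_pM2l// !lef_pV2 ?posrE// xbe.
    apply: ler_wpDl; first by rewrite mulr_ge0 ?phi_ge0.
    have x1 : 1 <= x by rewrite (le_trans be1)// ltW.
    have xa0 : 0 < c / x <= a0.
      rewrite divr_gt0//= ler_pdivrMr// mulrC -ler_pdivrMr//.
      exact: le_trans (ltW bex).
    have /andP[_] := LM0 _ xa0; rewrite powE// mulrA => Lx.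
    have xm : x `^ (- K) <= x ^+ m by rewrite -powR_mulrn ?(ltW x0)// ler_powR.
    rewrite /C3 -mulrA -phi_mul_exp mulrCA ler_wpM2l ?phi_ge0//.
    apply: (le_trans Lx); rewrite ler_wpM2l// mulr_ge0 ?powR_ge0//; exact: ltW.
Qed.

End first_order.

End finite_risk.

(** * First-order condition at the optimal scale *)

Section minimal_scale.
Context {R : realType}.
Local Notation mu := (@lebesgue_measure R).
Variables (L : R -> R) (v : R).
Hypothesis L_ge0 : forall x : R, 0 < x -> 0 <= L x.
Hypothesis v_gt0 : 0 < v.
Hypothesis L_ni : {in `]0, v] &, nonincreasing_fun L}.
Hypothesis L_nd : {in `[v, +oo[ &, nondecreasing_fun L}.

Let mL := @measurable_loss_div _ _ _ v_gt0 L_ni L_nd.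

Lemma measurable_phiL k (c : R) : 0 < c ->
  measurable_fun (`]0, +oo[ : set R) (fun x => phi k x * L (c / x)).
Proof. by move=> c0; apply: measurable_funM; [exact: measurable_phi|exact: mL]. Qed.

Lemma phiL_ge0 k (c x : R) : 0 < c -> 0 < x -> 0 <= phi k x * L (c / x).
Proof. by move=> c0 x0; rewrite mulr_ge0 ?phi_ge0// L_ge0// divr_gt0. Qed.

Lemma asym_risk_ge0 r c : 0 < c -> (0 <= asym_risk r L c)%E.
Proof.
move=> c0; apply: integral_ge0 => x /=; rewrite in_itv/= andbT => x0.
by rewrite lee_fin phiL_ge0.
Qed.

Let bernoulli r (d : R) : 0 <= 1 + d -> (1 - r%:R * d) * (1 + d) ^+ r <= 1.
Proof.
move=> d0; apply: (@le_trans _ _ (expR (- (r%:R * d)) * expR (r%:R * d))); last first.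
  by rewrite -expRD addNr expR0.
apply: (@le_trans _ _ (expR (- (r%:R * d)) * (1 + d) ^+ r)).
  by rewrite ler_wpM2r ?exprn_ge0//; exact: expR_ge1Dx.
rewrite ler_pM2l ?expR_gt0// expRM_natl; apply: lerXn2r; rewrite ?nnegrE ?expR_ge0//.
exact: expR_ge1Dx.
Qed.

(** The density at scale [s] is [s ^+ r.+1 * phi r.+1 u * expR (- (d * u))]; the exponential is
    bounded by its second-order expansion, and each factor [u] raises the Gamma shape by one. The
    linear term stands on the left so that no extended reals are subtracted. *)
Let scaled_le r (c d : R) (s := 1 + d) : 0 < c -> 0 <= d ->
  (asym_risk r.+1 L (s * c) + (s ^+ r.+1 * d * r.+1%:R)%:E * asym_risk r.+2 L c <=
   (s ^+ r.+1)%:E * asym_risk r.+1 L c +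
   (s ^+ r.+1 * d ^+ 2 / 2 * (r.+1%:R * r.+2%:R))%:E * asym_risk r.+3 L c)%E.
Proof.
move=> c0 d0; have s0 : 0 < s by rewrite ltr_wpDr.
have sr0 : 0 <= s ^+ r.+1 by rewrite exprn_ge0// ltW.
rewrite (asym_risk_scale L_ge0 v_gt0 L_ni L_nd)// /asym_risk.
have mphis k : measurable_fun (`]0, +oo[ : set R) (fun u => phi k (s * u)).
  apply: measurable_funTS; apply: continuous_measurable_fun => x.
  apply: continuous_comp; last exact: continuous_poisson_term.
  by apply: cvgM; [exact: cvg_cst|exact: cvg_id].
have x0 (x : R) : x \in `]0, +oo[ -> 0 < x by rewrite in_itv/= andbT.
have mphi k := @measurable_phiL k c c0.
have phi0 k x := @phiL_ge0 k c x c0.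
have ms : measurable_fun (`]0, +oo[ : set R) (fun u => s * phi r.+1 (s * u) * L (c / u)).
  by apply: measurable_funM; [exact: measurable_funM|exact: mL].
have s1 (u : R) : 0 < u -> 0 <= s * phi r.+1 (s * u) * L (c / u).
  move=> u0; apply: mulr_ge0; last by rewrite L_ge0// divr_gt0.
  by rewrite mulr_ge0 ?(ltW s0)// phi_ge0// mulr_gt0.
have C1 : 0 <= s ^+ r.+1 * d * r.+1%:R by rewrite !mulr_ge0.
have C2 : 0 <= s ^+ r.+1 * d ^+ 2 / 2 * (r.+1%:R * r.+2%:R).
  by rewrite !mulr_ge0 ?invr_ge0.
rewrite -!ge0_integralZlR//; try by move=> u /x0; exact: phi0.
rewrite -!ge0_integralDR//; try exact: measurable_funM;
  try (by move=> u /x0 u0; rewrite mulr_ge0 ?phi0); try by move=> u /x0; exact: s1.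
apply: ge0_le_integralR => //.
- by apply: measurable_funD => //; exact: measurable_funM.
- by apply: measurable_funD; exact: measurable_funM.
move=> u /x0 u0; apply/andP; split.
  by apply: addr_ge0; [exact: s1|apply: mulr_ge0 => //; exact: phi0].
rewrite !(mulrA _ (phi _ _)) -!mulrDl.
rewrite ler_wpM2r ?L_ge0 ?divr_gt0//.
rewrite !phiE/= !(poisson_termS _ u).
have -> : s * poisson_term r (s * u) = s ^+ r.+1 * (poisson_term r u * expR (- (d * u))).
  rewrite /poisson_term (_ : - (s * u) = - u + - (d * u)); last by rewrite /s; ring.
  by rewrite expRD exprMn exprS; ring.
have t0 := poisson_term_ge0 r (ltW u0).
have /(ler_wpM2l t0) := expRN_le_taylor2 (mulr_ge0 d0 (ltW u0)).
move=> /(ler_wpM2l sr0) h.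
rewrite -lerBrDr (le_trans h)// le_eqVlt; apply/orP; left; apply/eqP.
have r1 : r.+1%:R != 0 :> R by [].
have r2 : r.+2%:R != 0 :> R by [].
move: r1 r2; set x1 : R := r.+1%:R; set x2 : R := r.+2%:R => r1 r2.
clearbody x1 x2.
by field; rewrite r1 r2.
Qed.

(** Minimality is tested against [(1 + d) * c] for small [d]. Bernoulli's inequality removes the
    power of [1 + d] to first order, and what is left bounds the risk at shape [r.+2] by that at
    [r.+1] up to a term of order [d]. *)
Lemma asym_risk_min_next r (c : R) : 0 < c ->
  (forall c', 0 < c' -> (asym_risk r.+1 L c <= asym_risk r.+1 L c')%E) ->
  (asym_risk r.+2 L c < +oo)%E -> (asym_risk r.+3 L c < +oo)%E ->
  (asym_risk r.+2 L c <= asym_risk r.+1 L c)%E.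
Proof.
move=> c0 cmin fin1 fin2.
have [fin0|] := ltP (asym_risk r.+1 L c) +oo%E; last first.
  by rewrite leye_eq => /eqP ->; exact: leey.
have fin k : (asym_risk k L c < +oo)%E ->
    exists2 A : R, asym_risk k L c = A%:E & 0 <= A.
  move=> fk; exists (fine (asym_risk k L c)).
    by rewrite fineK// ge0_fin_numE// asym_risk_ge0.
  by rewrite fine_ge0// asym_risk_ge0.
have [A0 E0 A00] := fin _ fin0; have [A1 E1 A10] := fin _ fin1.
have [A2 E2 A20] := fin _ fin2.
rewrite E1 E0 lee_fin; apply/ler_addgt0Pr => e e0.
pose rho : R := r.+1%:R; have rho0 : 0 < rho by [].
pose C := rho * r.+2%:R / 2 * A2.
have C0 : 0 <= C by rewrite !mulr_ge0.
(* The first bound makes [1 - rho * d] nonnegative; the second makes the quadratic remainder [d * C]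
   at most [e * rho]. *)
pose d := Num.min rho^-1 (e * rho / (C + 1)).
have d0 : 0 < d by rewrite lt_min invr_gt0 rho0 divr_gt0 ?mulr_gt0 ?ltr_wpDl.
have dC : d * C <= e * rho.
  apply: (@le_trans _ _ (e * rho / (C + 1) * C)).
    by rewrite ler_wpM2r// ge_min lexx orbT.
  by rewrite -mulrA ler_piMr ?mulr_ge0 ?(ltW e0)// mulrC ler_pdivrMr ?ltr_wpDl// mul1r lerDl.
have rd : 0 <= 1 - rho * d.
  by rewrite subr_ge0 -ler_pdivlMl// mulr1 ge_min lexx.
have s0 : 0 < 1 + d by rewrite addr_gt0.
have := scaled_le r c0 (ltW d0).
have := cmin _ (mulr_gt0 s0 c0).
move=> /(leeD2r ((((1 + d) ^+ r.+1 * d * r.+1%:R)%:E * asym_risk r.+2 L c)%E))/le_trans h/h.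
rewrite E0 E1 E2 -!EFinM -!EFinD lee_fin -/rho => {}h.
pose X := A0 - d * rho * A1 + d ^+ 2 * C.
have hX : A0 <= (1 + d) ^+ r.+1 * X.
  by move: h; rewrite /X /C; move: (_ ^+ r.+1) (r.+2%:R) => s y; lra.
have S0 : 0 < (1 + d) ^+ r.+1 by exact: exprn_gt0.
have X0 : 0 <= X by rewrite -(pmulr_rge0 _ S0) (le_trans A00).
have hb := bernoulli r.+1 (ltW s0).
have : A0 * (1 - rho * d) <= X.
  apply: (le_trans (ler_wpM2r rd hX)); rewrite mulrAC ler_piMl//.
  by rewrite mulrC.
rewrite /X => hh.
have : d * (rho * A1) <= d * (rho * A0 + d * C) by lra.
rewrite ler_pM2l// => h1.
have : rho * A1 <= rho * (A0 + e) by lra.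
by rewrite ler_pM2l.
Qed.

End minimal_scale.

(** * Upper bound: the risk at every [p] *)

Section nonasymptotic_risk.
Context {R : realType}.
Local Notation mu := (@lebesgue_measure R).
Variables (L : R -> R) (v : R).
Hypothesis L_ge0 : forall x : R, 0 < x -> 0 <= L x.
Hypothesis v_gt0 : 0 < v.
Hypothesis L_ni : {in `]0, v] &, nonincreasing_fun L}.
Hypothesis L_nd : {in `[v, +oo[ &, nondecreasing_fun L}.

Lemma measurable_loss_scale (p : R) : 0 < p ->
  measurable_fun (`]0, +oo[ : set R) (fun y => L (y / p)).
Proof.
move=> p0.
apply: (measurable_comp (measurable_itv `]0, +oo[)) (measurable_loss v_gt0 L_ni L_nd) _.
  by move=> _ [x + <-]; rewrite /= !in_itv/= !andbT => x0; rewrite divr_gt0.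
exact: measurable_funTS (mulrr_measurable _).
Qed.

(** The Stieltjes measure of a unit step and the Dirac measure agree on half-open intervals, hence
    everywhere. *)
Lemma integral_point_mass (g : R) (f : R -> R) : 0 < g ->
  measurable_fun (`]0, +oo[ : set R) f -> (forall y, 0 < y -> 0 <= f y) ->
  (\int[lebesgue_stieltjes_measure (point_mass g)]_(y in `]0%R, +oo[) (f y)%:E
   = (f g)%:E)%E.
Proof.
move=> g0 mf f0.
transitivity (\int[\d_(g : measurableTypeR R)]_(y in `]0%R, +oo[) (f y)%:E)%E; last first.
  rewrite integral_dirac//; last exact/measurable_EFinP.
  by rewrite diracE mem_set ?mul1e//= in_itv/= g0.
apply: eq_measure_integral => A mA _; apply: lebesgue_stieltjes_measure_unique => //.
move=> X oX; rewrite /lebesgue_stieltjes_measure/= /measure_extension.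
rewrite measurable_mu_extE//=.
case/ocitvP : oX => [->|[[a b] /= ab ->]]; first by rewrite wlength0 measure0.
rewrite wlength_itv_bnd ?(ltW ab)// diracE; congr EFin.
rewrite /point_mass/= /step_cdf.
have [ag|ga] := ltP a g.
  rewrite subr0; congr (nat_of_bool _)%:R.
  by apply/idP/idP => [gb|]; [rewrite inE/= in_itv/= ag|rewrite inE/= in_itv/= => /andP[]].
rewrite (le_trans ga (ltW ab)) subrr memNset//=.
by rewrite in_itv/= ltNge ga.
Qed.

Lemma ibs_pmf_ge0 r p n : 0 < p < 1 -> 0 <= ibs_pmf r p n :> R.
Proof.
move=> /andP[p0 p1]; rewrite /ibs_pmf !mulr_ge0 ?exprn_ge0 ?subr_ge0//; exact: ltW.
Qed.

Lemma risk_nonrandomizedE r (g : nat -> R) p : 0 < p < 1 ->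
  (forall n, 0 < g n) ->
  risk r L (nonrandomized g) p =
  (\sum_(r <= n <oo) (ibs_pmf r p n * L (g n / p))%:E)%E.
Proof.
move=> /andP[p0 p1] g0; rewrite /risk; apply: eq_eseriesr => n _.
rewrite integral_point_mass ?EFinM//; first exact: measurable_loss_scale.
by move=> y y0; rewrite L_ge0// divr_gt0.
Qed.

Variables (r : nat) (Omega v' : R).
Hypothesis r_gt1 : (1 < r.+1)%N.
Hypothesis Omega_gt0 : 0 < Omega.
Hypothesis v_le : v <= Omega / (r.+1%:R + Num.sqrt r.+1%:R + 1).
Hypothesis v'_ge : v' >= Omega / (r.+1%:R - Num.sqrt r.+1%:R).
Hypothesis L_cst : {in `[v, v'] &, forall x y, L x = L y}.

(** The excess over the minimal loss, cut along the flat stretch. In [u] the order is reversed: [kL]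
    carries the large arguments of [L] and lives on [u <= Omega / v'], at most [r.+1 - sqrt r.+1];
    [kR] carries the small ones and lives on [u >= Omega / v], at least [r.+1 + sqrt r.+1 + 1].
    These are the ranges of [ibs_tail_left] and [ibs_tail_right]. *)
Let k u := L (Omega / u) - L v.
Let kL u := if u <= Omega / v' then k u else 0.
Let kR u := if Omega / v <= u then k u else 0.

Let sqrt_lt : 1 < Num.sqrt (r.+1%:R : R) < r.+1%:R.
Proof.
have s1 : 1 < Num.sqrt r.+1%:R :> R.
  by rewrite -[ltLHS]sqrtr1 ltr_sqrt ?ltr1n// ltr0n.
rewrite s1/= -[ltRHS](@sqr_sqrtr R)// expr2 ltr_pMr// (lt_trans _ s1)//.
Qed.

Let v'_gt0 : 0 < v'.
Proof.
apply: lt_le_trans v'_ge; rewrite divr_gt0// subr_gt0.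
by case/andP: sqrt_lt.
Qed.

Let lt_vv' : v < v'.
Proof.
apply: (le_lt_trans v_le); apply: lt_le_trans v'_ge.
have /andP[s1 sr] := sqrt_lt.
rewrite ltr_pM2l// ltf_pV2 ?posrE//; lra.
Qed.

Let div_gt0 u : 0 < u -> 0 < Omega / u.
Proof. exact: divr_gt0. Qed.

Let k_ge0 u : 0 < u -> 0 <= k u.
Proof. by move=> u0; rewrite subr_ge0 (loss_min v_gt0 L_ni L_nd) ?div_gt0. Qed.

Let kL_ge0 u : 0 < u -> 0 <= kL u.
Proof. by move=> u0; rewrite /kL; case: ifP => // _; exact: k_ge0. Qed.

Let kR_ge0 u : 0 < u -> 0 <= kR u.
Proof. by move=> u0; rewrite /kR; case: ifP => // _; exact: k_ge0. Qed.

Let kL_ni : {in `]0, +oo[ &, nonincreasing_fun kL}.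
Proof.
move=> s t; rewrite !in_itv/= !andbT => s0 t0 st; rewrite /kL.
case: ifPn => [tv|_]; last exact: kL_ge0.
rewrite (le_trans st tv) lerD2r.
have vt : v' <= Omega / t by rewrite ler_pdivlMr// mulrC -ler_pdivlMr.
have ts : Omega / t <= Omega / s by rewrite ler_pM2l// lef_pV2.
apply: L_nd => //; rewrite in_itv/= andbT.
  by rewrite (le_trans _ vt)// ltW.
by rewrite (le_trans _ ts)// (le_trans _ vt)// ltW.
Qed.

Let kR_nd : {in `]0, +oo[ &, nondecreasing_fun kR}.
Proof.
move=> s t; rewrite !in_itv/= !andbT => s0 t0 st; rewrite /kR.
case: ifPn => [sv|_]; last exact: kR_ge0.
rewrite (le_trans sv st) lerD2r.
have sv' : Omega / s <= v by rewrite ler_pdivrMr// mulrC -ler_pdivrMr.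
have ts : Omega / t <= Omega / s by rewrite ler_pM2l// lef_pV2.
apply: L_ni => //; rewrite in_itv/= div_gt0//=.
exact: le_trans sv'.
Qed.

Let loss_split u : 0 < u -> L (Omega / u) = L v + (kL u + kR u).
Proof.
move=> u0; rewrite /kL /kR /k.
have vv : Omega / v' < Omega / v by rewrite ltr_pM2l// ltf_pV2.
have [u1|u1] := leP u (Omega / v').
  by rewrite leNgt (le_lt_trans u1 vv)/=; ring.
have [u2|u2] := leP (Omega / v) u; first by ring.
rewrite addr0 addr0; apply: L_cst; rewrite in_itv/= ?lexx ?(ltW lt_vv')//.
rewrite ler_pdivlMr// mulrC -ler_pdivlMr// (ltW u2)/=.
by rewrite ler_pdivrMr// mulrC -ler_pdivrMr// ltW.
Qed.

Variable p : R.
Hypothesis p01 : 0 < p < 1.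

Let p_gt0 : 0 < p. Proof. by case/andP: p01. Qed.

Let p01' : 0 <= p <= 1. Proof. by case/andP: p01 => /ltW -> /ltW ->. Qed.

(** [x n] is the value of [(N + 1) p] at [N = n], so that the loss there is [L (Omega / x n)]. The
    predecessor in [B] makes it the probability of [N >= n]. *)
Let x n := n.+1%:R * p.
Let B n := binomial_tail n.-1 r.+1 p.
Let psi := mixture_density r.+1 p.
Let Psi := mixture_tail r.+1 p.

Let pmfE n : (r < n)%N -> ibs_pmf r.+1 p n = B n - B n.+1.
Proof. by move=> rn; rewrite ibs_pmfE. Qed.

Let x_gt0 n : 0 < x n. Proof. exact: mulr_gt0. Qed.

Let x_nd n : x n <= x n.+1.
Proof. by rewrite /x ler_pM2r// ler_nat. Qed.

Let B_ge0 n : (r < n)%N -> 0 <= B n.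
Proof. by move=> _; apply: sumr_ge0 => i _; exact: binomial_term_ge0. Qed.

Let B_ni n : (r < n)%N -> B n.+1 <= B n.
Proof. by move=> rn; rewrite -subr_ge0 -pmfE// ibs_pmf_ge0. Qed.

Let psi_ge0 y : 0 < y -> 0 <= psi y.
Proof. by move=> /ltW; exact: mixture_density_ge0. Qed.

Let mpsi D : measurable D -> measurable_fun D psi.
Proof.
move=> mD; apply: measurable_funTS; apply: continuous_measurable_fun.
exact: continuous_mixture_density.
Qed.

Let PsiE (y : R) : 0 < y -> (\int[mu]_(z in `[y, +oo[) (psi z)%:E = (Psi y)%:E)%E.
Proof. by move=> /ltW; exact: integral_mixture_density. Qed.

Let B_init : B r.+1 = 1. Proof. exact: binomial_tail_total. Qed.

Let psi_total : (\int[mu]_(z in `]0%R, +oo[) (psi z)%:E = (B r.+1)%:E)%E.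
Proof.
rewrite integral_itv_obnd_cbnd; last by apply/measurable_EFinP; exact: mpsi.
by rewrite integral_mixture_density// mixture_tail0 B_init.
Qed.

Let mkL : measurable_fun (`]0, +oo[ : set R) kL.
Proof. exact: measurable_fun_nonincreasing_itv. Qed.

Let mkR : measurable_fun (`]0, +oo[ : set R) kR.
Proof. exact: measurable_fun_nondecreasing_itv. Qed.

(** The constant [L v] is compared through total mass, [kL] through left tails and [kR] through
    right tails; partial sums suffice because all terms are nonnegative. *)
Let partial_le m :
  ((\sum_(r.+1 <= n < r.+1 + m) ibs_pmf r.+1 p n * L (Omega / x n))%:E <=
   \int[mu]_(y in `]0%R, +oo[) (psi y * L (Omega / y))%:E)%E.
Proof.
have -> : \sum_(r.+1 <= n < r.+1 + m) ibs_pmf r.+1 p n * L (Omega / x n) =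
    L v * (B r.+1 - B (r.+1 + m)%N) +
    (\sum_(r.+1 <= n < r.+1 + m) (B n - B n.+1) * kL (x n) +
     \sum_(r.+1 <= n < r.+1 + m) (B n - B n.+1) * kR (x n)).
  rewrite -[B _ - _]opprB -(telescope_sumr (fun n => B n)) ?leq_addr//.
  rewrite mulrN -mulrN -sumrN mulr_sumr -!big_split/=.
  rewrite !big_nat; apply: eq_bigr => n /andP[rn _].
  by rewrite pmfE// loss_split//; ring.
have pos0 (y : R) : y \in `]0, +oo[ -> 0 < y by rewrite in_itv/= andbT.
have mk (k' : R -> R) : measurable_fun (`]0, +oo[ : set R) k' ->
  measurable_fun (`]0, +oo[ : set R) (fun y => psi y * k' y).
  by move=> mk'; apply: measurable_funM => //; exact: mpsi.
have mono (k' : R -> R) : (forall y, 0 < y -> 0 <= k' y) ->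
  forall y, y \in `]0, +oo[ -> 0 <= psi y * k' y.
  by move=> k0 y /pos0 y0; rewrite mulr_ge0 ?psi_ge0 ?k0.
have -> : (\int[mu]_(y in `]0%R, +oo[) (psi y * L (Omega / y))%:E =
   \int[mu]_(y in `]0%R, +oo[) (L v * psi y)%:E +
   (\int[mu]_(y in `]0%R, +oo[) (psi y * kL y)%:E +
    \int[mu]_(y in `]0%R, +oo[) (psi y * kR y)%:E))%E.
  rewrite -!ge0_integralDR//; try exact: mk; try exact: mono.
  - by apply: eq_integral => y; rewrite inE => /pos0 y0; rewrite loss_split//; congr EFin; ring.
  - by apply: measurable_funM => //; exact: mpsi.
  - by apply: measurable_funD; exact: mk.
  - by move=> y /pos0 y0; rewrite mulr_ge0 ?psi_ge0// L_ge0.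
  - by move=> y y0; rewrite addr_ge0//; exact: mono.
rewrite !EFinD leeD//; last first.
  apply: leeD.
    apply: (nonincreasing_tail_le (Psi := Psi)) => //; first exact: mpsi.
    move=> n rn; rewrite /kL; case: ifPn => [nv _|]; last by rewrite ltxx.
    apply: ibs_tail_left => //; apply: (le_trans nv).
    rewrite ler_pdivrMr// mulrC -ler_pdivrMr//.
    by rewrite subr_gt0; case/andP: sqrt_lt.
  apply: (nondecreasing_tail_le (Psi := Psi)) => //; first exact: mpsi.
  move=> n rn; rewrite /kR; case: ifPn => [nv _|]; last by rewrite ltxx.
  apply: ibs_tail_right => //; apply: le_trans nv.
  rewrite ler_pdivlMr// mulrC -ler_pdivlMr//.
rewrite ge0_integralZlR//; [|exact: mpsi|by move=> y /pos0; exact: psi_ge0|exact: L_ge0].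
rewrite psi_total -EFinM lee_fin ler_wpM2l ?L_ge0// gerBl B_ge0//.
by rewrite ltn_addr.
Qed.

Lemma risk_le_asym_risk :
  (asym_risk r.+2 L Omega <= asym_risk r.+1 L Omega)%E ->
  (risk r.+1 L (nonrandomized (fun n => Omega / (n%:R + 1))%R) p <=
   asym_risk r.+1 L Omega)%E.
Proof.
move=> next; rewrite risk_nonrandomizedE//; last first.
  by move=> n; rewrite divr_gt0// ltr_wpDl.
have term_ge0 n : (0 <= (ibs_pmf r.+1 p n * L (Omega / (n%:R + 1) / p))%:E)%E.
  by rewrite lee_fin mulr_ge0 ?ibs_pmf_ge0// L_ge0// !divr_gt0// ltr_wpDl.
apply: (@le_trans _ _ (\int[mu]_(y in `]0%R, +oo[) (psi y * L (Omega / y))%:E)%E).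
  apply: lime_le; first by apply: is_cvg_nneseries => n _ _; exact: term_ge0.
  apply: nearW => n; have [nr|rn] := leqP n r.+1.
    rewrite big_geq//; apply: integral_ge0 => y /=; rewrite in_itv/= andbT => y0.
    by rewrite lee_fin mulr_ge0 ?psi_ge0// L_ge0// div_gt0.
  rewrite -(subnKC (ltnW rn)) sumEFin.
  apply: le_trans (partial_le _).
  rewrite lee_fin le_eqVlt; apply/orP; left; apply/eqP.
  apply: eq_bigr => i _; rewrite /x -natr1; congr (_ * L _); field.
  by rewrite (gt_eqF p_gt0)/= gt_eqF// ltr_wpDl.
have pos0 (y : R) : y \in `]0, +oo[ -> 0 < y by rewrite in_itv/= andbT.
have /andP[p0 p1] := p01.
have -> : (\int[mu]_(y in `]0%R, +oo[) (psi y * L (Omega / y))%:E =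
   (1 - p)%:E * asym_risk r.+1 L Omega + p%:E * asym_risk r.+2 L Omega)%E.
  have mphi k' := measurable_phiL v_gt0 L_ni L_nd k' Omega_gt0.
  have phi0 k' y := @phiL_ge0 _ L L_ge0 k' Omega y Omega_gt0.
  rewrite /asym_risk -!ge0_integralZlR ?subr_ge0 ?(ltW p0) ?(ltW p1)//;
    try by move=> y /pos0; exact: phi0.
  rewrite -ge0_integralDR//; try exact: measurable_funM.
  - by apply: eq_integral => y _; rewrite /psi /mixture_density; congr EFin; ring.
  - by move=> y /pos0 y0; rewrite mulr_ge0 ?phi0// subr_ge0 ltW.
  - by move=> y /pos0 y0; rewrite mulr_ge0 ?phi0// ltW.
have A0 := @asym_risk_ge0 _ L L_ge0 r.+1 Omega Omega_gt0.
apply: (@le_trans _ _ ((1 - p)%:E * asym_risk r.+1 L Omega + p%:E * asym_risk r.+1 L Omega)%E).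
  by rewrite leeD2l// lee_wpmul2l// lee_fin ltW.
rewrite -ge0_muleDl ?lee_fin ?subr_ge0 ?(ltW p0) ?(ltW p1)//.
by rewrite -EFinD subrK mul1e.
Qed.

End nonasymptotic_risk.

(** * Lower bound: truncating the asymptotic risk uniformly in the scale *)

Section truncated_risk.
Context {R : realType}.
Local Notation mu := (@lebesgue_measure R).

Definition window (A x : R) : R := (A^-1 <= x <= A)%R%:R.

Lemma window_ge0 A x : 0 <= window A x.
Proof. exact: ler0n. Qed.

Lemma window_le1 A x : window A x <= 1.
Proof. by rewrite /window; case: (_ && _). Qed.

Lemma le_window A B x : 0 < A -> A <= B -> window A x <= window B x.
Proof.
move=> A0 AB; rewrite /window; have [/andP[x1 x2]|//] := boolP (A^-1 <= x <= A).
suff -> : B^-1 <= x <= B by [].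
by rewrite (le_trans x2 AB) andbT (le_trans _ x1)// lef_pV2 ?posrE// (lt_le_trans A0).
Qed.

Lemma measurable_window A (D : set R) : measurable_fun D (window A).
Proof.
rewrite (_ : window A = \1_(`[A^-1, A]%classic : set R)).
  exact: measurable_indic.
apply/funext => x; rewrite /window indicE; congr (nat_of_bool _)%:R.
by apply/idP/idP; rewrite inE/= in_itv.
Qed.

Variables (L : R -> R) (v : R).
Hypothesis L_ge0 : forall x : R, 0 < x -> 0 <= L x.
Hypothesis v_gt0 : 0 < v.
Hypothesis L_ni : {in `]0, v] &, nonincreasing_fun L}.
Hypothesis L_nd : {in `[v, +oo[ &, nondecreasing_fun L}.

(** With [nu = n p], the window is a range on which the pmf is uniformly close to the Gamma
    density. *)
Definition truncated_risk r A Omega : \bar R :=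
  (\int[mu]_(nu in `]0%R, +oo[) (window A nu * (phi r nu * L (Omega / nu)))%:E)%E.

Variable r : nat.

Let pos (x : R) : x \in `]0, +oo[ -> 0 < x.
Proof. by rewrite in_itv/= andbT. Qed.

Let mphiL (c : R) : 0 < c ->
  measurable_fun (`]0, +oo[ : set R) (fun x => phi r.+1 x * L (c / x)).
Proof. exact: (@measurable_phiL _ L v). Qed.

Let phiL0 (c x : R) : 0 < c -> 0 < x -> 0 <= phi r.+1 x * L (c / x).
Proof. exact: (@phiL_ge0 _ L). Qed.

Lemma poisson_tail_cvgy k : @poisson_tail R k x @[x --> +oo] --> (0 : R).
Proof.
have -> : @poisson_tail R k = mixture_tail k 0.
  by apply/funext => x; rewrite /mixture_tail mul0r addr0.
exact: mixture_tail_cvgy.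
Qed.

Lemma poisson_tail0 k : poisson_tail k.+1 0 = 1 :> R.
Proof. by rewrite -(mixture_tail0 k 0) /mixture_tail mul0r addr0. Qed.

Lemma integral_phi_total k : (\int[mu]_(x in `]0%R, +oo[) (phi k.+1 x)%:E = 1)%E.
Proof.
rewrite integral_itv_obnd_cbnd; first by rewrite integral_phi// poisson_tail0.
by apply/measurable_EFinP; exact: measurable_phi.
Qed.

Let window_mass A : 1 <= A ->
  ((poisson_tail r.+1 A^-1 - poisson_tail r.+1 A)%:E <=
   \int[mu]_(x in `]0%R, +oo[) (window A x * phi r.+1 x)%:E)%E.
Proof.
move=> A1; have A0 : 0 < A by rewrite (lt_le_trans _ A1).
have V0 : 0 < A^-1 by rewrite invr_gt0.
have VA : A^-1 <= A by rewrite (le_trans _ A1)// invf_le1.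
have mphi D : measurable D -> measurable_fun D (@phi R r.+1) by exact: measurable_phi.
have sub (y : R) : y \in `[A^-1, +oo[ -> 0 < y.
  by rewrite in_itv/= andbT; exact: lt_le_trans.
have := @ge0_integral_itv_split _ (@phi R r.+1) (BLeft A^-1) (BLeft A) +oo%O.
rewrite !bnd_simp !integral_phi ?(ltW A0) ?(ltW V0)// => /(_ VA isT (mphi _ _) _) h.
rewrite EFinB h ?addeK//; last by move=> y /sub; exact: phi_ge0.
have sub' (y : R) : y \in `[A^-1, A[ -> 0 < y.
  by rewrite in_itv/= => /andP[y1 _]; exact: lt_le_trans y1.
apply: (@le_trans _ _ (\int[mu]_(x in `[A^-1%R, A[) (window A x * phi r.+1 x)%:E)%E).
  apply: ge0_le_integralR => //.
  - exact: mphi.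
  - by apply: measurable_funM; [exact: measurable_window|exact: mphi].
  - move=> y yA; rewrite phi_ge0 ?sub'//= /window.
    move: yA; rewrite /= in_itv/= => /andP[-> /ltW ->]; by rewrite mul1r.
apply: ge0_subset_integral => //.
- apply/measurable_EFinP; apply: measurable_funM; [exact: measurable_window|exact: mphi].
- by move=> y /pos y0; rewrite lee_fin mulr_ge0 ?window_ge0 ?phi_ge0.
- by move=> y /sub' y0; rewrite /= in_itv/= andbT.
Qed.

Let truncated_ge_cst A c C : 1 <= A -> 0 < c -> 0 <= C ->
  (forall x, c / A <= x <= c * A -> C <= L x) ->
  ((C * (poisson_tail r.+1 A^-1 - poisson_tail r.+1 A))%:E
   <= truncated_risk r.+1 A c)%E.
Proof.
move=> A1 c0 C0 CL; have A0 : 0 < A by rewrite (lt_le_trans _ A1).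
have mw : measurable_fun (`]0, +oo[ : set R) (fun x => window A x * phi r.+1 x).
  by apply: measurable_funM; [exact: measurable_window|exact: measurable_phi].
rewrite EFinM; apply: le_trans (lee_wpmul2l _ (window_mass A1)) _ => //.
rewrite -ge0_integralZlR//; last first.
  by move=> y /pos y0; rewrite mulr_ge0 ?window_ge0 ?phi_ge0.
apply: ge0_le_integralR => //.
- exact: measurable_funM.
- by apply: measurable_funM; [exact: measurable_window|exact: mphiL].
- move=> y /pos y0; apply/andP; split.
    by rewrite mulr_ge0// mulr_ge0 ?window_ge0 ?phi_ge0.
  rewrite /window.
  have [/andP[y1 y2]|_] := boolP (A^-1 <= y <= A); last by rewrite !mul0r mulr0.
  rewrite !mul1r mulrC ler_wpM2l ?phi_ge0// CL//.
  rewrite ler_pM2l// lef_pV2 ?posrE// y2/= ler_pM2l//.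
  by rewrite -[leRHS]invrK lef_pV2 ?posrE ?invr_gt0.
Qed.

Let phi_scale (s u : R) :
  s * phi r.+1 (s * u) = s ^+ r.+1 * (phi r.+1 u * expR (- ((s - 1) * u))).
Proof.
rewrite /phi/= (_ : - (s * u) = - u + - ((s - 1) * u)); last by ring.
by rewrite expRD exprMn exprS; ring.
Qed.

Let measurable_phi_scale (s : R) :
  measurable_fun (`]0, +oo[ : set R) (fun u => s * phi r.+1 (s * u)).
Proof.
apply: measurable_funM => //.
apply: measurable_funTS; apply: continuous_measurable_fun => x.
apply: continuous_comp; last exact: continuous_poisson_term.
by apply: cvgM; [exact: cvg_cst|exact: cvg_id].
Qed.

Let phi_scale_ge0 (s u : R) : 0 < s -> 0 < u -> 0 <= s * phi r.+1 (s * u).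
Proof. by move=> s0 u0; rewrite mulr_ge0 ?(ltW s0)// phi_ge0// mulr_gt0. Qed.

Let integral_phi_scale (s : R) : 0 < s ->
  (\int[mu]_(u in `]0%R, +oo[) (s * phi r.+1 (s * u))%:E = 1)%E.
Proof.
move=> s0; rewrite -(@ge0_integral_scale _ s (@phi R r.+1))//.
- exact: integral_phi_total.
- exact: measurable_phi.
- by move=> x; exact: phi_ge0.
Qed.

Variable eta : R.
Hypothesis eta_le : forall c, 0 < c -> (eta%:E <= asym_risk r.+1 L c)%E.
Hypothesis risk_lty : forall c, 0 < c -> (asym_risk r.+1 L c < +oo)%E.

Let risk_fin c : 0 < c -> exists2 I : R, asym_risk r.+1 L c = I%:E & 0 <= I.
Proof.
move=> c0; have A0 := @asym_risk_ge0 _ L L_ge0 r.+1 c c0.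
exists (fine (asym_risk r.+1 L c)); last exact: fine_ge0.
by rewrite fineK// ge0_fin_numE// risk_lty.
Qed.

(** The bound [eta_le] is tested at scale [s]. One part of the loss is charged with [C] to the
    scaled density, of mass [1]; the remainder is charged to the finite risk [I] at scale [1]. *)
Let eta_le_scale (s C K I : R) : 0 < s -> 0 <= C -> 0 <= K ->
  asym_risk r.+1 L 1 = I%:E ->
  (forall u, 0 < u -> s * phi r.+1 (s * u) * L (1 / u) <=
    C * (s * phi r.+1 (s * u)) + K * (phi r.+1 u * L (1 / u))) ->
  eta <= C + K * I.
Proof.
move=> s0 C0 K0 IE sle; rewrite -lee_fin.
apply: (le_trans (eta_le (mulr_gt0 s0 ltr01))).
rewrite (asym_risk_scale L_ge0 v_gt0 L_ni L_nd)// EFinD EFinM -IE.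
rewrite -[in leRHS](mule1 C%:E) -(integral_phi_scale s0) /asym_risk.
have mp := measurable_phi_scale s.
have mp1 := mphiL ltr01.
have p0 u : u \in `]0, +oo[ -> 0 <= s * phi r.+1 (s * u).
  by move=> /pos; exact: phi_scale_ge0.
have p1 u : u \in `]0, +oo[ -> 0 <= phi r.+1 u * L (1 / u).
  by move=> /pos; exact: phiL0.
rewrite -!ge0_integralZlR// -ge0_integralDR//; try exact: measurable_funM.
- apply: ge0_le_integralR => //.
  + by apply: measurable_funM => //; exact: (measurable_loss_div v_gt0 L_ni L_nd).
  + by apply: measurable_funD; exact: measurable_funM.
  + move=> u u0; rewrite sle ?pos// andbT; apply: mulr_ge0; first exact: p0.
    by rewrite L_ge0// divr_gt0// pos.
- by move=> u u0; rewrite mulr_ge0// p0.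
- by move=> u u0; rewrite mulr_ge0// p1.
Qed.

(** As [s] grows, the scaled density concentrates near [u = 0], where [1 / u >= v]. Beyond
    [b = 1 / v] it is at most [s ^+ r.+1 * expR (- ((s - 1) * b))] times [phi r.+1 u], and this
    factor tends to [0]. *)
Let eta_le_sup_right C : (forall x, v <= x -> L x <= C) -> eta <= C.
Proof.
move=> LC; have C0 : 0 <= C by rewrite (le_trans (L_ge0 v_gt0)) ?LC.
have [I IE I0] := risk_fin ltr01.
pose b := 1 / v; have b0 : 0 < b by rewrite divr_gt0.
apply/ler_addgt0Pr => e e0.
(* Chosen so that the factor above times [I] equals [poisson_term r.+1 (s * b) * K1], whose limit is
   known. *)
pose K1 := (r.+1)`!%:R / b ^+ r.+1 * expR b * I.
have K10 : 0 <= K1 by rewrite !mulr_ge0 ?expR_ge0 ?invr_ge0 ?exprn_ge0// ltW.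
have [s [s1 sK]] : exists s, 1 <= s /\ poisson_term r.+1 (s * b) * K1 <= e.
  have e1 : 0 < e / (K1 + 1) by rewrite divr_gt0// ltr_wpDl.
  have /cvgrPdist_lt/(_ _ e1) h := @poisson_term_cvgy R r.+1.
  near (pinfty_nbhs R) => x; exists (x / b).
  have xb : b <= x by near: x; apply: nbhs_pinfty_ge; exact: num_real.
  rewrite divfK ?gt_eqF// ler_pdivlMr// mul1r; split => //.
  have : `|0 - poisson_term r.+1 x| < e / (K1 + 1) by near: x; exact: h.
  rewrite sub0r normrN ger0_norm ?poisson_term_ge0 ?(le_trans _ xb) ?(ltW b0)// => /ltW h'.
  apply: (le_trans (ler_wpM2r K10 h')); rewrite mulrAC ler_pdivrMr ?ltr_wpDl//.
  by rewrite ler_pM2l// lerDl.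
have s0 : 0 < s by rewrite (lt_le_trans _ s1).
apply: le_trans (_ : C + s ^+ r.+1 * expR (- ((s - 1) * b)) * I <= _).
  apply: (eta_le_scale s0) => //; first by rewrite mulr_ge0 ?exprn_ge0 ?expR_ge0// ltW.
  move=> u u0; have L0 : 0 <= L (1 / u) by rewrite L_ge0 ?divr_gt0.
  have [ub|bu] := leP u b.
    apply: ler_wpDr; last first.
      by rewrite mulrC ler_wpM2r ?phi_scale_ge0// LC// /b !div1r -[v]invrK lef_pV2
        ?posrE ?invr_gt0// -div1r.
    by rewrite mulr_ge0 ?phiL0 ?mulr_ge0 ?exprn_ge0 ?expR_ge0// ltW.
  apply: ler_wpDl; first by rewrite mulr_ge0 ?phi_scale_ge0.
  rewrite phi_scale.
  have -> : s ^+ r.+1 * expR (- ((s - 1) * b)) * (phi r.+1 u * L (1 / u)) =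
      s ^+ r.+1 * (phi r.+1 u * expR (- ((s - 1) * b))) * L (1 / u) by ring.
  rewrite ler_wpM2r// ler_pM2l ?exprn_gt0// ler_wpM2l ?phi_ge0//.
  by rewrite ler_expR lerN2 ler_wpM2l ?subr_ge0// ltW.
rewrite lerD2l; apply: le_trans sK.
rewrite /K1 /poisson_term exprMn le_eqVlt; apply/orP; left; apply/eqP.
rewrite (_ : - ((s - 1) * b) = - (s * b) + b); last by ring.
rewrite expRD; field.
by rewrite !lt0r_neq0 ?exprn_gt0// ltr0n fact_gt0.
Unshelve. all: by end_near. Qed.

(** As [s] tends to [0] the mass escapes to large [u], where [1 / u <= v]; below [b] the scaled
    density is at most [s * expR b] times [phi r.+1 u]. *)
Let eta_le_sup_left C : (forall x, 0 < x <= v -> L x <= C) -> eta <= C.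
Proof.
move=> LC; have C0 : 0 <= C by rewrite (le_trans (L_ge0 v_gt0)) ?LC// v_gt0/=.
have [I IE I0] := risk_fin ltr01.
pose b := 1 / v; have b0 : 0 < b by rewrite divr_gt0.
apply/ler_addgt0Pr => e e0.
pose K := expR b * I; have K0 : 0 <= K by rewrite mulr_ge0 ?expR_ge0.
pose s := Num.min 1 (e / (K + 1)).
have s0 : 0 < s by rewrite lt_min ltr01 divr_gt0// ltr_wpDl.
have s1 : s <= 1 by rewrite ge_min lexx.
apply: le_trans (_ : C + s * expR b * I <= _); last first.
  rewrite lerD2l -mulrA -/K (@le_trans _ _ (e / (K + 1) * K))//.
    by rewrite ler_wpM2r// ge_min lexx orbT.
  by rewrite mulrAC ler_pdivrMr ?ltr_wpDl// ler_pM2l// lerDl.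
apply: (eta_le_scale s0) => //; first by rewrite mulr_ge0 ?expR_ge0// ltW.
move=> u u0; have L0 : 0 <= L (1 / u) by rewrite L_ge0 ?divr_gt0.
have [bu|ub] := leP b u.
  apply: ler_wpDr; last first.
    rewrite mulrC ler_wpM2r ?phi_scale_ge0// LC// divr_gt0//= ler_pdivrMr//.
    by rewrite mulrC -ler_pdivrMr.
  by rewrite mulr_ge0 ?phiL0 ?mulr_ge0 ?expR_ge0// ltW.
apply: ler_wpDl; first by rewrite mulr_ge0 ?phi_scale_ge0.
rewrite phi_scale.
have -> : s * expR b * (phi r.+1 u * L (1 / u)) =
    s * (phi r.+1 u * expR b) * L (1 / u) by ring.
rewrite ler_wpM2r//; apply: ler_pM.
- by rewrite exprn_ge0// ltW.
- by rewrite mulr_ge0 ?phi_ge0 ?expR_ge0.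
- by rewrite exprS ler_piMr ?exprn_ile1 ?(ltW s0).
rewrite ler_wpM2l ?phi_ge0//.
rewrite ler_expR -mulNr opprB (@le_trans _ _ u) ?(ltW ub)//.
by rewrite ler_piMl ?(ltW u0)// lerBlDr lerDl ltW.
Qed.

Let outside_small (c e : R) : 0 < c -> 0 < e -> exists D, 1 <= D /\
  (\int[mu]_(u in `]0%R, +oo[) ((1 - window D u) * (phi r.+1 u * L (c / u)))%:E <= e%:E)%E.
Proof.
move=> c0 e0; have [I IE I0] := risk_fin c0.
pose g u := phi r.+1 u * L (c / u).
have mg : measurable_fun (`]0, +oo[ : set R) g by exact: mphiL.
have g0 u : u \in `]0, +oo[ -> 0 <= g u by move=> /pos; exact: phiL0.
have mw D : measurable_fun (`]0, +oo[ : set R) (fun u => window D u * g u).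
  by apply: measurable_funM => //; exact: measurable_window.
have wg0 D u : u \in `]0, +oo[ -> 0 <= window D u * g u.
  by move=> u0; rewrite mulr_ge0 ?window_ge0 ?g0.
have cv : ((\int[mu]_(u in `]0%R, +oo[) (window n.+1%:R u * g u)%:E) @[n --> \oo] -->
    \int[mu]_(u in `]0%R, +oo[) (g u)%:E)%E.
  have -> : (\int[mu]_(u in `]0%R, +oo[) (g u)%:E =
    \int[mu]_(u in `]0%R, +oo[) limn (fun n => (window n.+1%:R u * g u)%:E))%E.
    apply: eq_integral => u; rewrite inE => /pos u0.
    apply/esym/cvg_lim => //; apply: cvg_near_cst.
    near=> n; apply/eqP; rewrite /window.
    have un : u <= n.+1%:R.
      rewrite (@le_trans _ _ n%:R) ?ler_nat//.
      by near: n; exact: nbhs_infty_ger.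
    have nu : u^-1 <= n.+1%:R.
      rewrite (@le_trans _ _ n%:R) ?ler_nat//.
      by near: n; exact: nbhs_infty_ger.
    by rewrite un andbT -[u]invrK lef_pV2 ?posrE ?invr_gt0// nu mul1r.
  apply: cvg_monotone_convergence => //.
  - by move=> n; apply/measurable_EFinP; exact: mw.
  - by move=> n u u0; rewrite lee_fin wg0.
  - move=> u u0 m n mn; rewrite lee_fin ler_wpM2r ?g0//.
    by apply: le_window; rewrite ?ler_nat.
have gI : (\int[mu]_(u in `]0%R, +oo[) (g u)%:E = I%:E)%E by rewrite -IE.
rewrite gI in cv.
have [n nI] : exists n, (I%:E - e%:E <=
    \int[mu]_(u in `]0%R, +oo[) (window n.+1%:R u * g u)%:E)%E.
  apply: contrapT => /forallNP h.
  have : (I%:E <= I%:E - e%:E)%E.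
    rewrite -[leLHS](cvg_lim (@ereal_hausdorff R) cv); apply: lime_le.
      by apply/cvg_ex; exists I%:E.
    by apply: nearW => n; rewrite leNgt; apply/negP => /ltW; exact: h.
  by rewrite -EFinB lee_fin lerBrDr gerDl leNgt e0.
exists n.+1%:R; split; first by rewrite ler1n.
set W := (X in (X <= _)%E).
have : (\int[mu]_(u in `]0%R, +oo[) (window n.+1%:R u * g u)%:E + W = I%:E)%E.
  rewrite -gI -ge0_integralDR//.
  - by apply: eq_integral => u _; rewrite /g; congr EFin; ring.
  - apply: measurable_funM => //; apply: measurable_funB => //.
    exact: measurable_window.
  - exact: wg0.
  - by move=> u u0; rewrite mulr_ge0 ?g0// subr_ge0 window_le1.
move=> WE; rewrite -(@leeD2lE _ (I - e)%:E)//.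
by rewrite -EFinD subrK -WE leeD2r// EFinB.
Unshelve. all: by end_near. Qed.

Let poisson_mass_near1 (q : R) : q < 1 -> exists A : R, 1 < A /\
  q <= poisson_tail r.+1 A^-1 - poisson_tail r.+1 A.
Proof.
move=> q1; pose e := (1 - q) / 2; have e0 : 0 < e by rewrite divr_gt0// subr_gt0.
have /cvgrPdist_lt/(_ _ e0) h1 := @poisson_tail_cvgy r.+1.
have c0 : poisson_tail r.+1 x^-1 @[x --> +oo] --> (1 : R).
  rewrite -(poisson_tail0 r).
  have [/derivable1_diffP/differentiable_continuous cF _] := is_derive_poisson_tail r (0 : R).
  have cV : (x : R)^-1 @[x --> +oo] --> (0 : R).
    by apply/(gtr0_cvgV0 (f:=id)); [exact: nbhs_pinfty_gt|exact: cvg_id].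
  exact: (cvg_comp _ _ cV cF).
have /cvgrPdist_lt/(_ _ e0) h2 := c0.
near (pinfty_nbhs R) => A; exists A; split.
  by near: A; apply: nbhs_pinfty_gt; exact: num_real.
have : `|0 - poisson_tail r.+1 A| < e by near: A; exact: h1.
have : `|1 - poisson_tail r.+1 A^-1| < e by near: A; exact: h2.
rewrite !ltr_norml => /andP[_ h3] /andP[h4 _].
have eE : e + e = 1 - q by rewrite /e; field.
lra.
Unshelve. all: by end_near. Qed.

(** Uniformity in [Omega] is the point. On both sides of [v] the loss must reach every level below
    [eta], so for very large or very small [Omega] the window sees only losses at least [c'], and a
    window of mass near [1] is enough. The remaining scales fill a compact range from [lo] to [hi],
    where every scaled density is at most a fixed multiple of the one at [lo]. *)
Lemma truncated_risk_ge (c : R) : 0 <= c -> c < eta -> exists A, 1 < A /\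
  forall Omega, 0 < Omega -> (c%:E <= truncated_risk r.+1 A Omega)%E.
Proof.
move=> c0 ceta; pose c' := (c + eta) / 2.
have [cc' c'eta] : c < c' /\ c' < eta by rewrite /c'; split; lra.
have c'0 : 0 < c' by rewrite (le_lt_trans c0).
have [xhi vxhi Lxhi] : exists2 x, v <= x & c' <= L x.
  apply: contrapT => /forall2NP h; suff : eta <= c' by rewrite leNgt c'eta.
  apply: eta_le_sup_right => x vx; have [//|/negP] := h x.
  by rewrite -ltNge => /ltW.
have [xlo /andP[xlo0 xlov] Lxlo] : exists2 x, 0 < x <= v & c' <= L x.
  apply: contrapT => /forall2NP h; suff : eta <= c' by rewrite leNgt c'eta.
  apply: eta_le_sup_left => x xv; have [//|/negP] := h x.
  by rewrite -ltNge => /ltW.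
(* A window of mass at least [c / c'] retains [c] from a loss that is at least [c'] on it. *)
have [|A0 [A0gt1 A0q]] := @poisson_mass_near1 (c / c').
  by rewrite ltr_pdivrMr// mul1r.
have A01 := ltW A0gt1.
have A00 : 0 < A0 by rewrite (lt_le_trans _ A01).
have far Omega : 0 < Omega -> (forall x, Omega / A0 <= x <= Omega * A0 -> c' <= L x) ->
    (c%:E <= truncated_risk r.+1 A0 Omega)%E.
  move=> O0 /(truncated_ge_cst A01 O0 (ltW c'0)); apply: le_trans.
  by rewrite lee_fin -ler_pdivrMl// mulrC.
pose lo := xlo / A0; pose hi := xhi * A0.
have lo0 : 0 < lo by rewrite divr_gt0.
have xhi0 : 0 < xhi by rewrite (lt_le_trans v_gt0).
have lohi : lo <= hi.
  rewrite /lo ler_pdivrMr// (le_trans xlov)// (le_trans vxhi)// /hi.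
  by rewrite -mulrA ler_peMr ?(ltW xhi0)// mulr_ege1.
pose H := hi / lo; have H1 : 1 <= H by rewrite ler_pdivlMr// mul1r.
have H0 : 0 < H by rewrite (lt_le_trans _ H1).
have HS : 0 < H ^+ r.+1 by rewrite exprn_gt0.
have [|D [D1 De]] := @outside_small lo ((eta - c) / H ^+ r.+1) lo0.
  by rewrite divr_gt0// subr_gt0.
have D0 : 0 < D by rewrite (lt_le_trans _ D1).
(* For [u] in the window of [D] and [1 <= s <= H], the point [s * u] lies between [D^-1] and
   [H * D], hence in the window of [A]. *)
pose A := Num.max A0 (H * D).
have AA0 : A0 <= A by rewrite le_max lexx.
have AHD : H * D <= A by rewrite le_max lexx orbT.
have Agt0 : 0 < A by rewrite (lt_le_trans A00).
exists A; split; first by rewrite (lt_le_trans A0gt1).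
move=> Omega O0.
have mwL B (c1 : R) : 0 < c1 -> measurable_fun (`]0, +oo[ : set R)
    (fun u => window B u * (phi r.+1 u * L (c1 / u))).
  by move=> c10; apply: measurable_funM; [exact: measurable_window|exact: mphiL].
have widen : (truncated_risk r.+1 A0 Omega <= truncated_risk r.+1 A Omega)%E.
  apply: ge0_le_integralR; [exact: measurable_itv|exact: mwL|exact: mwL|].
  move=> u /pos u0; rewrite mulr_ge0 ?window_ge0 ?phiL0//=.
  by rewrite ler_wpM2r ?phiL0// le_window.
have [hiO|Ohi] := leP hi Omega.
  apply: le_trans (far _ O0 _) widen => x /andP[Ox _].
  have xx : xhi <= x by rewrite (le_trans _ Ox)// ler_pdivlMr.
  apply: (le_trans Lxhi); apply: L_nd => //; rewrite in_itv/= andbT//.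
  exact: le_trans xx.
have [Olo|loO] := leP Omega lo.
  apply: le_trans (far _ O0 _) widen => x /andP[Ox1 Ox].
  have xx : x <= xlo by rewrite (le_trans Ox)// -ler_pdivlMr.
  have x0 : 0 < x by rewrite (lt_le_trans _ Ox1)// divr_gt0.
  apply: (le_trans Lxlo); apply: L_ni => //; rewrite in_itv/= ?xlo0 ?x0//.
  exact: le_trans xlov.
pose s := Omega / lo.
have OE : Omega = s * lo by rewrite /s divfK ?gt_eqF.
have s0 : 0 < s by rewrite divr_gt0.
have s1 : 1 <= s by rewrite ler_pdivlMr// mul1r ltW.
have sH : s <= H by rewrite ler_pM2r ?invr_gt0// ltW.
clearbody s.
have mps := measurable_phi_scale s.
have mLlo := measurable_loss_div v_gt0 L_ni L_nd lo0.
have Llo0 u : 0 < u -> 0 <= L (lo / u) by move=> u0; rewrite L_ge0// divr_gt0.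
have mws : measurable_fun (`]0, +oo[ : set R) (fun u => window A (s * u)).
  apply: (@measurableT_comp _ _ _ _ _ _ (window A)); first exact: measurable_window.
  exact: measurable_funTS (mulrl_measurable _).
have TE : truncated_risk r.+1 A Omega = (\int[mu]_(u in `]0%R, +oo[)
    (window A (s * u) * (s * phi r.+1 (s * u) * L (lo / u)))%:E)%E.
  rewrite /truncated_risk (ge0_integral_scale s0); last 2 first.
  - exact: mwL.
  - by move=> u u0; rewrite mulr_ge0 ?window_ge0 ?phiL0.
  apply: eq_integral => u; rewrite inE => /pos u0; congr EFin.
  have -> : Omega / (s * u) = lo / u.
    by rewrite OE invfM mulrACA divff ?mul1r// gt_eqF.
  by rewrite mulrCA !mulrA.
have mout : measurable_fun (`]0, +oo[ : set R)
    (fun u => (1 - window D u) * (phi r.+1 u * L (lo / u))).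
  apply: measurable_funM; last exact: mphiL.
  by apply: measurable_funB => //; exact: measurable_window.
have out0 u : 0 < u -> 0 <= (1 - window D u) * (phi r.+1 u * L (lo / u)).
  by move=> u0; rewrite mulr_ge0 ?phiL0// subr_ge0 window_le1.
have : (eta%:E <= truncated_risk r.+1 A Omega + (eta - c)%:E)%E.
  apply: (le_trans (eta_le O0)); rewrite OE (asym_risk_scale L_ge0 v_gt0 L_ni L_nd)//.
  rewrite -OE TE.
  have HE : ((H ^+ r.+1)%:E * \int[mu]_(u in `]0%R, +oo[)
       ((1 - window D u) * (phi r.+1 u * L (lo / u)))%:E <= (eta - c)%:E)%E.
    apply: (le_trans (lee_wpmul2l _ De)); first by rewrite lee_fin ltW.
    by rewrite -EFinM mulrC divfK// gt_eqF.
  apply: le_trans (leeD2l _ HE).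
  rewrite -ge0_integralZlR ?(ltW HS)//; last by move=> u /pos; exact: out0.
  have win0 u : 0 < u ->
      0 <= window A (s * u) * (s * phi r.+1 (s * u) * L (lo / u)).
    by move=> u0; rewrite mulr_ge0 ?window_ge0// mulr_ge0 ?phi_scale_ge0 ?Llo0.
  rewrite -ge0_integralDR//.
  - apply: ge0_le_integralR => //.
    + exact: measurable_funM.
    + by apply: measurable_funD; apply: measurable_funM => //; exact: measurable_funM.
    + move=> u /pos u0; rewrite mulr_ge0 ?phi_scale_ge0 ?Llo0//=.
      have [wA|wA] := boolP (A^-1 <= s * u <= A).
        have -> : window A (s * u) = 1 by rewrite /window wA.
        rewrite mul1r lerDl.
        by rewrite mulr_ge0 ?out0// ltW.
      have -> : window D u = 0.
        rewrite /window; have [/andP[Du uD]|//] := boolP (D^-1 <= u <= D).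
        case/negP: wA; rewrite (@le_trans _ _ u)//= ?ler_peMl ?(ltW u0)//.
          rewrite (le_trans _ AHD)// ler_pM ?(ltW s0) ?(ltW u0)//.
        apply: le_trans Du; rewrite lef_pV2 ?posrE// (le_trans _ AHD)//.
        by rewrite ler_peMl// ltW.
      apply: ler_wpDl; first by rewrite mulr_ge0 ?window_ge0// mulr_ge0 ?phi_scale_ge0 ?Llo0.
      rewrite subr0 mul1r phi_scale.
      apply: (@le_trans _ _ (s ^+ r.+1 * (phi r.+1 u * L (lo / u)))); last first.
        by rewrite ler_wpM2r ?phiL0// lerXn2r// nnegrE ltW.
      rewrite -(mulrA (s ^+ r.+1)) ler_pM2l ?exprn_gt0// ler_wpM2r ?Llo0//.
      rewrite ler_piMr ?phi_ge0// expR_le1 oppr_le0.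
      by rewrite mulr_ge0 ?subr_ge0// ltW.
  - by apply: measurable_funM => //; exact: measurable_funM.
  - exact: measurable_funM.
  - by move=> u /pos; exact: win0.
  - by move=> u /pos u0; rewrite mulr_ge0 ?(ltW HS)// out0.
move=> h; rewrite -(@leeD2rE _ (eta - c)%:E)//; apply: le_trans h.
by rewrite -EFinD addrCA subrr addr0.
Qed.

End truncated_risk.

(** * Bayes risk under the logarithmic prior *)

Section bayes_lower_bound.
Context {R : realType}.
Local Notation mu := (@lebesgue_measure R).

Lemma bernoulli_le (x : R) n : 0 <= x <= 1 -> 1 - n%:R * x <= (1 - x) ^+ n.
Proof.
move=> /andP[x0 x1]; elim: n => [|n IH]; first by rewrite mul0r subr0.
rewrite exprS (@le_trans _ _ ((1 - x) * (1 - n%:R * x)))//; last first.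
  by rewrite ler_wpM2l// subr_ge0.
have : 0 <= n%:R * x * x by rewrite !mulr_ge0.
rewrite -natr1; lra.
Qed.

Lemma binomial_coef_ge r n : (r <= n.-1)%N ->
  (n - r.+1)%:R ^+ r <= 'C(n.-1, r)%:R * r`!%:R :> R.
Proof.
move=> rn; rewrite -natrM bin_ffact -natrX ler_nat ffact_prod.
rewrite -[X in (_ ^ X <= _)%N]card_ord -prod_nat_const.
apply: leq_prod => i _; have := ltn_ord i; lia.
Qed.

(** Two relative losses occur: [r.+1 ^+ 2 / n] from replacing the falling factorial by a power, and
    [A ^+ 2 / n] from replacing a power of [1 - p] by an exponential, through
    [(1 - p) * expR p >= 1 - p ^+ 2]. [B] makes their sum at most [1 - theta] once [n >= B]. *)
Lemma ibs_pmf_ge_phi r (theta A : R) : 0 <= theta -> theta < 1 -> 1 <= A ->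
  exists N, [/\ (r < N)%N, A < N%:R & forall n p, (N <= n)%N -> 0 < p ->
    n%:R * p <= A -> theta * phi r.+1 (n%:R * p) * p <= ibs_pmf r.+1 p n].
Proof.
move=> theta0 t1 A1; pose B := (r.+1%:R ^+ 2 + A ^+ 2) / (1 - theta).
have t0 : 0 < 1 - theta by rewrite subr_gt0.
exists (maxn r.+2 (maxn (Num.truncn A).+1 (Num.truncn B).+1)); split.
- by rewrite (@leq_trans r.+2)// leq_maxl.
- by rewrite (lt_le_trans (truncnS_gt A))// ler_nat !leq_max leqnn orbT.
move=> n p; rewrite !geq_max => /andP[rn /andP[An Bn]] p0 npA.
have n0 : 0 < n%:R :> R by rewrite ltr0n (leq_trans _ rn).
have An' : A < n%:R by rewrite (lt_le_trans (truncnS_gt A))// ler_nat.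
have Bn' : B <= n%:R by rewrite (le_trans (ltW (truncnS_gt B)))// ler_nat.
have p1 : p < 1.
  by rewrite -(ltr_pM2l n0) mulr1 (le_lt_trans npA).
have q0 : 0 < 1 - p by rewrite subr_gt0.
rewrite /ibs_pmf /phi/=.
have np0 : 0 <= n%:R * p by rewrite mulr_ge0// ltW.
have pn2 : n%:R * p ^+ 2 <= A ^+ 2 / n%:R.
  rewrite ler_pdivlMr// (_ : _ * _ * _ = (n%:R * p) ^+ 2); last by ring.
  by rewrite ler_sqr ?nnegrE// (le_trans np0).
have H1 : (1 - A ^+ 2 / n%:R) * expR (- (n%:R * p)) <= (1 - p) ^+ (n - r.+1).
  rewrite expRN ler_pdivrMr ?expR_gt0//.
  apply: (@le_trans _ _ ((1 - p) ^+ n * expR (n%:R * p))); last first.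
    rewrite ler_wpM2r ?expR_ge0//.
    by apply: ler_wiXn2l; rewrite ?(ltW q0) ?leq_subr// lerBlDr lerDl ltW.
  rewrite expRM_natl -exprMn.
  apply: (@le_trans _ _ ((1 - p ^+ 2) ^+ n)).
    apply: le_trans (bernoulli_le _ _); first lra.
    by rewrite sqr_ge0/= exprn_ile1// ltW.
  apply: lerXn2r; rewrite ?nnegrE ?mulr_ge0 ?expR_ge0 ?(ltW q0)//.
    by rewrite subr_ge0 exprn_ile1// ltW.
  rewrite (_ : 1 - p ^+ 2 = (1 - p) * (1 + p)); last by ring.
  by rewrite ler_pM2l// expR_ge1Dx.
have H2 : (1 - r.+1%:R ^+ 2 / n%:R) * n%:R ^+ r <= (n - r.+1)%:R ^+ r :> R.
  rewrite natrB; last exact: ltnW.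
  have -> : n%:R - r.+1%:R = (1 - r.+1%:R / n%:R) * n%:R :> R.
    by rewrite mulrBl mul1r divfK// gt_eqF.
  rewrite exprMn ler_wpM2r ?exprn_ge0 ?(ltW n0)//.
  have rn1 : r.+1%:R / n%:R <= 1 :> R by rewrite ler_pdivrMr// mul1r ler_nat ltnW.
  apply: (@le_trans _ _ (1 - r%:R * (r.+1%:R / n%:R))).
    rewrite lerD2l lerN2 expr2 -[leRHS]mulrA ler_wpM2r ?divr_ge0 ?(ltW n0)//.
    by rewrite ler_nat.
  by apply: bernoulli_le; rewrite rn1 divr_ge0// ltW.
have rn' : (r <= n.-1)%N by case: (n) rn => // m; rewrite ltnS; exact: ltnW.
have f0 : 0 < r`!%:R :> R by rewrite ltr0n fact_gt0.
have H3 := @binomial_coef_ge r n rn'.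
have D0 : r.+1%:R ^+ 2 / n%:R + A ^+ 2 / n%:R <= 1 - theta.
  by rewrite -mulrDl ler_pdivrMr// mulrC -ler_pdivrMr.
have a0 : 0 <= r.+1%:R ^+ 2 / n%:R :> R by rewrite divr_ge0 ?sqr_ge0 ?(ltW n0).
have b0 : 0 <= A ^+ 2 / n%:R by rewrite divr_ge0 ?sqr_ge0 ?(ltW n0).
have D3 : theta <= (1 - r.+1%:R ^+ 2 / n%:R) * (1 - A ^+ 2 / n%:R).
  have := mulr_ge0 a0 b0; lra.
have D1 : 0 <= 1 - r.+1%:R ^+ 2 / n%:R :> R by lra.
have D2 : 0 <= 1 - A ^+ 2 / n%:R by lra.
move: D3 D1 D2 H1 H2 {D0 a0 b0}.
set a := 1 - r.+1%:R ^+ 2 / n%:R; set b := 1 - A ^+ 2 / n%:R => D3 D1 D2 H1 H2.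
rewrite -(ler_pM2r f0).
have -> : theta * ((n%:R * p) ^+ r * expR (- (n%:R * p)) / r`!%:R) * p * r`!%:R =
    theta * (n%:R ^+ r * expR (- (n%:R * p)) * p ^+ r.+1).
  by rewrite exprMn exprS; field; exact: lt0r_neq0.
have -> : 'C(n.-1, r)%:R * p ^+ r.+1 * (1 - p) ^+ (n - r.+1) * r`!%:R =
    'C(n.-1, r)%:R * r`!%:R * (1 - p) ^+ (n - r.+1) * p ^+ r.+1 by ring.
rewrite mulrA ler_wpM2r ?exprn_ge0 ?(ltW p0)//.
apply: (@le_trans _ _ (a * b * (n%:R ^+ r * expR (- (n%:R * p))))).
  by rewrite ler_wpM2r// mulr_ge0 ?expR_ge0// exprn_ge0// ltW.
have -> : a * b * (n%:R ^+ r * expR (- (n%:R * p))) =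
    (a * n%:R ^+ r) * (b * expR (- (n%:R * p))) by ring.
apply: ler_pM => //.
- by rewrite mulr_ge0// exprn_ge0// ltW.
- by rewrite mulr_ge0 ?expR_ge0.
- exact: le_trans H2 H3.
Qed.

Lemma lebesgue_stieltjes_positive (F : cumulativeBounded (0 : R) (1 : R)) : F 0 = 0 ->
  (1 <= lebesgue_stieltjes_measure F `]0%R, +oo[%classic)%E.
Proof.
move=> F0; apply/lee_addgt0Pr => e e0.
have /cvgrPdist_lt/(_ _ e0) h := cumulativey F.
near (pinfty_nbhs R) => x.
have x0 : 0 < x by near: x; apply: nbhs_pinfty_gt; exact: num_real.
have : `|1 - F x| < e by near: x; exact: h.
rewrite ltr_norml => /andP[_ xe].
apply: (@le_trans _ _ ((F x)%:E + e%:E)%E); first by rewrite -EFinD lee_fin; lra.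
rewrite leeD2r//.
have -> : (F x)%:E = lebesgue_stieltjes_measure F `]0, x]%classic.
  rewrite /lebesgue_stieltjes_measure/= /measure_extension.
  rewrite measurable_mu_extE//=; last exact: is_ocitv.
  by rewrite wlength_itv_bnd ?(ltW x0)// F0 subr0.
apply: le_measure; rewrite ?inE//.
by move=> y /=; rewrite !in_itv/= => /andP[-> _].
Unshelve. all: by end_near. Qed.

Variables (L : R -> R) (v : R).
Hypothesis L_ge0 : forall x : R, 0 < x -> 0 <= L x.
Hypothesis v_gt0 : 0 < v.
Hypothesis L_ni : {in `]0, v] &, nonincreasing_fun L}.
Hypothesis L_nd : {in `[v, +oo[ &, nondecreasing_fun L}.

Let pos (x : R) : x \in `]0, +oo[ -> 0 < x.
Proof. by rewrite in_itv/= andbT. Qed.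

Definition conditional_risk (F : cumulativeBounded (0 : R) (1 : R)) (p : R) : \bar R :=
  (\int[lebesgue_stieltjes_measure F]_(y in `]0%R, +oo[) (L (y / p))%:E)%E.

Lemma conditional_risk_ge0 F p : 0 < p -> (0 <= conditional_risk F p)%E.
Proof.
by move=> p0; apply: integral_ge0 => y /pos y0; rewrite lee_fin L_ge0// divr_gt0.
Qed.

Let posR : set R := `]0, +oo[%classic.
(** The loss on the whole plane, [0] off the open positive quadrant. In this form joint
    measurability, needed to exchange integrals, follows by composition. *)
Let K (z : R * R) : \bar R := ((L \_ posR) (z.1 * (GRing.inv \_ posR) z.2))%:E.

Let mK : measurable_fun setT K.
Proof.
apply/measurable_EFinP; apply: (@measurableT_comp _ _ _ _ _ _ (L \_ posR)).
  apply: (measurable_restrictT _ (measurable_itv _)).1.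
  exact: (measurable_loss v_gt0 L_ni L_nd).
apply: measurable_funM => //.
apply: (@measurableT_comp _ _ _ _ _ _ (GRing.inv \_ posR)) => //.
apply: (measurable_restrictT _ (measurable_itv _)).1.
apply: measurable_fun_nonincreasing_itv => s t /pos s0 /pos t0 st.
by rewrite lef_pV2.
Qed.

Let K_ge0 z : (0 <= K z)%E.
Proof.
rewrite lee_fin /patch; case: ifPn => // /[!inE] /pos; exact: L_ge0.
Qed.

Let invE p : 0 < p -> (GRing.inv \_ posR) p = p^-1.
Proof. by move=> p0; rewrite /patch mem_set// /posR/= in_itv/= p0. Qed.

Let KE y p : 0 < p -> 0 < y -> K (y, p) = (L (y / p))%:E.
Proof.
move=> p0 y0; rewrite /K/= invE// /patch mem_set//.
by rewrite /posR/= in_itv/= divr_gt0.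
Qed.

Let conditional_riskE F p : 0 < p ->
  conditional_risk F p = (\int[lebesgue_stieltjes_measure F]_y K (y, p))%E.
Proof.
move=> p0; rewrite /conditional_risk integral_mkcond.
apply: eq_integral => y _; rewrite /patch; case: ifPn => [/[!inE] /pos y0|].
  by rewrite KE.
rewrite notin_setE/= in_itv/= andbT => /negP yN0.
rewrite /K/= invE// /patch memNset//.
by rewrite /posR/= in_itv/= andbT pmulr_lgt0 ?invr_gt0//; exact/negP.
Qed.

Lemma measurable_conditional_risk F (W : set R) : measurable W ->
  W `<=` `]0, +oo[ -> measurable_fun W (conditional_risk F).
Proof.
move=> mW W0.
apply: (eq_measurable_fun (fun p => \int[lebesgue_stieltjes_measure F]_y K (y, p))%E).
  by move=> p; rewrite inE => /W0/pos p0; rewrite conditional_riskE.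
apply: measurable_funTS.
exact: (measurable_fun_fubini_tonelli_G (m1 := lebesgue_stieltjes_measure F) K).
Qed.

Let measurable_window_phi r (A : R) n :
  measurable_fun setT (fun p : R => window A (n%:R * p) * phi r (n%:R * p)).
Proof.
apply: measurable_funM.
  apply: (@measurableT_comp _ _ _ _ _ _ (window A)); first exact: measurable_window.
  exact: mulrl_measurable.
apply: (@measurableT_comp _ _ _ _ _ _ (@phi R r)); first exact: measurable_phi.
exact: mulrl_measurable.
Qed.

(** After exchanging the integrals, the substitution [nu = n p] turns the inner one, for an estimate
    [y], into [1 / n] times the truncated risk at [Omega = n y]. Its bound does not depend on [y],
    so [F] merely integrates a constant. *)
Lemma integral_conditional_risk_ge r (A c : R) n
    (F : cumulativeBounded (0 : R) (1 : R)) (W : set R) :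
  0 < A -> (0 < n)%N -> 0 <= c -> F 0 = 0 ->
  (forall Omega, 0 < Omega -> (c%:E <= truncated_risk L r.+1 A Omega)%E) ->
  measurable W -> W `<=` `]0, +oo[ ->
  (forall p : R, A^-1 <= n%:R * p <= A -> W p) ->
  ((c / n%:R)%:E <= \int[mu]_(p in W)
     ((window A (n%:R * p) * phi r.+1 (n%:R * p))%:E * conditional_risk F p))%E.
Proof.
move=> A0 n0 c0 F0 cT mW W0 wW.
have nR0 : 0 < n%:R :> R by rewrite ltr0n.
pose w p := window A (n%:R * p) * phi r.+1 (n%:R * p).
have w_out p : ~ W p -> w p = 0.
  move=> Wp; rewrite /w /window; have [/wW//|_] := boolP (_ <= _ <= _).
  by rewrite mul0r.
have w0 p : 0 <= w p.
  have [Wp|/w_out ->//] := pselect (W p).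
  by rewrite mulr_ge0 ?window_ge0// phi_ge0// mulr_gt0// pos//; exact: W0.
have mw : measurable_fun setT w by exact: measurable_window_phi.
pose f (z : R * R) : \bar R := ((w z.2)%:E * K z)%E.
have mf : measurable_fun setT f.
  apply: emeasurable_funM => //; apply/measurable_EFinP.
  exact: (@measurableT_comp _ _ _ _ _ _ w).
have f0 z : (0 <= f z)%E by rewrite mule_ge0 ?K_ge0// lee_fin.
have -> : (\int[mu]_(p in W) ((w p)%:E * conditional_risk F p) =
    \int[mu]_p \int[lebesgue_stieltjes_measure F]_y f (y, p))%E.
  rewrite integral_mkcond; apply: eq_integral => p _; rewrite /patch.
  case: ifPn => [/[!inE] Wp|].
    rewrite conditional_riskE ?pos//; last exact: W0.
    rewrite -ge0_integralZl ?lee_fin//.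
    exact: measurableT_comp.
  rewrite notin_setE => /w_out wp; rewrite /f/= wp integral0_eq// => y _.
  by rewrite mul0e.
rewrite -(fubini_tonelli (m1 := lebesgue_stieltjes_measure F) (m2 := mu) f)//.
apply: (@le_trans _ _ (\int[lebesgue_stieltjes_measure F]_(y in `]0%R, +oo[) (c / n%:R)%:E)%E).
  rewrite integral_cst//; rewrite -[leLHS]mule1 lee_wpmul2l//.
    by rewrite lee_fin divr_ge0// ltW.
  exact: lebesgue_stieltjes_positive.
apply: (@le_trans _ _ (\int[lebesgue_stieltjes_measure F]_(y in `]0%R, +oo[)
   \int[mu]_p f (y, p))%E); last first.
  apply: ge0_subset_integral => //.
    exact: (measurable_fun_fubini_tonelli_F (m2 := mu) f).
  by move=> y _; exact: integral_ge0.
apply: ge0_le_integral => //.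
- by move=> y _; rewrite lee_fin divr_ge0// ltW.
- apply: measurable_funTS.
  exact: (measurable_fun_fubini_tonelli_F (m2 := mu) f).
move=> y /pos y0.
apply: (@le_trans _ _ (\int[mu]_(p in `]0%R, +oo[) f (y, p))%E); last first.
  apply: ge0_subset_integral => //.
  exact: measurableT_comp.
have -> : (\int[mu]_(p in `]0%R, +oo[) f (y, p) =
   \int[mu]_(p in `]0%R, +oo[) (w p * L (y / p))%:E)%E.
  by apply: eq_integral => p; rewrite inE => /pos p0; rewrite /f KE.
have mwL : measurable_fun (`]0, +oo[ : set R) (fun p => w p * L (y / p)).
  apply: measurable_funM; first exact: measurable_funTS.
  exact: (measurable_loss_div v_gt0 L_ni L_nd).
have wL0 p : 0 < p -> 0 <= w p * L (y / p).
  by move=> p0; rewrite mulr_ge0// L_ge0// divr_gt0.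
have := cT _ (mulr_gt0 nR0 y0); rewrite /truncated_risk (ge0_integral_scale nR0).
- have -> : (\int[mu]_(x in `]0%R, +oo[) (n%:R *
      (window A (n%:R * x) * (phi r.+1 (n%:R * x) * L (n%:R * y / (n%:R * x)))))%:E =
      \int[mu]_(x in `]0%R, +oo[) (n%:R * (w x * L (y / x)))%:E)%E.
    apply: eq_integral => x; rewrite inE => /pos x0.
    have -> : n%:R * y / (n%:R * x) = y / x.
      by rewrite -mulf_div divff ?mul1r// gt_eqF.
    by rewrite /w [in RHS]mulrA [in LHS]mulrA [in LHS]mulrA [in RHS]mulrA.
  rewrite ge0_integralZlR ?(ltW nR0)//; last by move=> x /pos; exact: wL0.
  by rewrite mulrC EFinM lee_pdivrMl.
- apply: measurable_funM; first exact: measurable_window.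
  by apply: (measurable_phiL v_gt0 L_ni L_nd); rewrite mulr_gt0.
- by move=> x x0; rewrite mulr_ge0 ?window_ge0// (phiL_ge0 L_ge0)// mulr_gt0.
Qed.

Lemma ln_le_harmonic N k : (0 < N)%N ->
  ln (N + k)%:R - ln N%:R <= \sum_(N <= n < N + k) (n%:R : R)^-1.
Proof.
move=> N0; elim: k => [|k IH]; first by rewrite addn0 subrr big_geq.
rewrite addnS big_nat_recr ?leq_addr//=.
have m0 : 0 < (N + k)%:R :> R by rewrite ltr0n ltn_addr.
have : ln (N + k).+1%:R - ln (N + k)%:R <= ((N + k)%:R : R)^-1.
  rewrite -ln_div ?posrE// -natr1 mulrDl divff ?gt_eqF// mul1r.
  by apply: le_ln1Dx; rewrite (lt_trans _ (_ : 0 < _)) ?invr_gt0 ?ltrN10.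
lra.
Qed.

Lemma integral_inv (a b S : R) : 0 < a -> a < b ->
  (\int[mu]_(p in `[a, b]) (S / p)%:E = (S * (ln b - ln a))%:E)%E.
Proof.
move=> a0 ab.
have d (x : R) : 0 < x -> is_derive x 1 (fun x => S * ln x) (S / x).
  move=> x0; have := is_derive1_ln x0 => ?.
  by apply: is_derive_eq; rewrite /GRing.scale/=; ring.
rewrite (@continuous_FTC2 _ _ (fun x => S * ln x))//.
- by rewrite -EFinB mulrBr.
- apply: continuous_in_subspaceT => x; rewrite inE/= in_itv/= => /andP[ax _].
  have x0 : 0 < x by exact: lt_le_trans ax.
  by apply: cvgM; [exact: cvg_cst|apply: cvgV; [exact: lt0r_neq0|exact: cvg_id]].
- split.
  + by move=> x; rewrite in_itv/= => /andP[ax _]; have := d x (lt_trans a0 ax); case.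
  + have [/derivable1_diffP/differentiable_continuous c _] := d a a0.
    exact: cvg_at_right_filter c.
  + have [/derivable1_diffP/differentiable_continuous c _] := d b (lt_trans a0 ab).
    exact: cvg_at_left_filter c.
- move=> x; rewrite in_itv/= => /andP[ax _]; rewrite derive1E.
  by have [_] := d x (lt_trans a0 ax).
Qed.

(* A risk bounded by [S] is integrated against the prior proportional to
   [1 / p] on [[1 / (A M), A / N]]; the normalized posterior given [n] tends to
   the Gamma law as [n] grows, which yields [c]. *)
Lemma risk_bound_harmonic r (Pi : @Defs.family R) (S theta A c : R) N k :
  estimator r.+1 Pi -> 0 <= S -> 0 <= theta -> 0 <= c -> 1 < A ->
  (r < N)%N -> A < N%:R ->
  (forall n p, (N <= n)%N -> 0 < p -> n%:R * p <= A ->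
    theta * phi r.+1 (n%:R * p) * p <= ibs_pmf r.+1 p n) ->
  (forall Omega, 0 < Omega -> (c%:E <= truncated_risk L r.+1 A Omega)%E) ->
  (forall p, 0 < p < 1 -> (risk r.+1 L Pi p <= S%:E)%E) ->
  theta * c * (ln (N + k)%:R - ln N%:R) <=
  S * (2 * ln A + (ln (N + k)%:R - ln N%:R)).
Proof.
move=> est S0 theta0 c0 A1 rN AN fge cT riskS.
have A0 : 0 < A by rewrite (lt_trans _ A1).
have N0 : (0 < N)%N by rewrite (leq_ltn_trans _ rN).
have NR0 : 0 < N%:R :> R by rewrite ltr0n.
have MR0 : 0 < (N + k)%:R :> R by rewrite ltr0n ltn_addr.
(* The interval contains [[1 / (A n), A / n]] for every [n] from [N] to [N + k - 1]. *)
pose a : R := (A * (N + k)%:R)^-1; pose b : R := A / N%:R.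
have a0 : 0 < a by rewrite invr_gt0 mulr_gt0.
have ab : a < b.
  rewrite /a /b invfM; apply: (@lt_le_trans _ _ (A * (N + k)%:R^-1)).
    by rewrite ltr_pM2r ?invr_gt0// (lt_trans _ A1)// invf_lt1.
  by rewrite ler_pM2l// lef_pV2 ?posrE// ler_nat leq_addr.
have b1 : b < 1 by rewrite ltr_pdivrMr// mul1r.
pose W : set R := `[a, b]%classic.
have mW : measurable W by exact: measurable_itv.
have W0 : W `<=` `]0, +oo[.
  by move=> p; rewrite /W /= !in_itv/= andbT => /andP[+ _]; exact: lt_le_trans.
have Wp p : W p -> 0 < p < 1.
  move=> pW; rewrite (pos (W0 _ pW))/=; move: pW; rewrite /W/= in_itv/= => /andP[_ pb].
  exact: le_lt_trans b1.
pose w n p := window A (n%:R * p) * phi r.+1 (n%:R * p).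
pose H n := conditional_risk (Pi n).
have w0 n p : W p -> 0 <= w n p.
  move=> /Wp/andP[p0 _]; rewrite mulr_ge0 ?window_ge0//.
  by rewrite phiE poisson_term_ge0// mulr_ge0// ltW.
have H0 n p : W p -> (0 <= H n p)%E.
  by move=> /Wp/andP[p0 _]; exact: conditional_risk_ge0.
have mw n : measurable_fun W (w n) by apply: measurable_funTS; exact: measurable_window_phi.
have mH n : measurable_fun W (H n) by exact: measurable_conditional_risk.
have mwH n : measurable_fun W (fun p => theta%:E * ((w n p)%:E * H n p))%E.
  by apply: measurable_funeM; apply: emeasurable_funM => //; exact/measurable_EFinP.
have twH0 n p : W p -> (0 <= theta%:E * ((w n p)%:E * H n p))%E.
  by move=> pW; rewrite mule_ge0 ?lee_fin// mule_ge0 ?H0// lee_fin w0.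
(* The prior factor [p^-1] cancels the [p] in [fge], both sides being trivial to compare outside the
   window; finitely many terms of the risk series are at most its sum. *)
have pointwise p : W p ->
    (\sum_(N <= n < N + k) theta%:E * ((w n p)%:E * H n p) <= (S / p)%:E)%E.
  move=> pW; have p01 := Wp p pW; have /andP[p0 p1] := p01.
  have fH0 n : (0 <= (ibs_pmf r.+1 p n)%:E * H n p)%E.
    by rewrite mule_ge0 ?H0// lee_fin ibs_pmf_ge0.
  apply: (@le_trans _ _ (\sum_(N <= n < N + k) (p^-1)%:E * ((ibs_pmf r.+1 p n)%:E * H n p))%E).
    rewrite !big_nat; apply: lee_sum => n /andP[Nn _].
    rewrite !muleA lee_wpmul2r ?H0// -!EFinM lee_fin ler_pdivlMl// /w /window.
    have [/andP[_ npA]|_] := boolP (A^-1 <= n%:R * p <= A).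
      by rewrite mul1r mulrC fge.
    by rewrite !(mul0r, mulr0) ibs_pmf_ge0.
  rewrite -ge0_sume_distrr//.
  rewrite mulrC EFinM lee_wpmul2l ?lee_fin ?invr_ge0 ?(ltW p0)//.
  apply: le_trans (riskS p p01).
  apply: (@le_trans _ _ (\sum_(r.+1 <= n < N + k) (ibs_pmf r.+1 p n)%:E * H n p)%E).
    rewrite (@big_cat_nat _ _ _ N r.+1)//= ?leq_addr//.
    by rewrite leeDr// sume_ge0.
  apply: nneseries_lim_ge => n _ _; exact: fH0.
have : (\sum_(N <= n < N + k) (theta * c / n%:R)%:E <=
   \int[mu]_(p in W) \sum_(N <= n < N + k) theta%:E * ((w n p)%:E * H n p))%E.
  rewrite ge0_integral_sum//.
  rewrite !big_nat; apply: lee_sum => n /andP[Nn nk].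
  have n0 : (0 < n)%N by rewrite (leq_trans N0).
  have nR0 : 0 < n%:R :> R by rewrite ltr0n.
  rewrite ge0_integralZl_EFin//.
  - rewrite -mulrA EFinM lee_wpmul2l ?lee_fin//.
    apply: integral_conditional_risk_ge => //.
    + by apply: est; rewrite (leq_trans rN).
    + move=> p /andP[np1 np2].
      have p0 : 0 < p by rewrite -(pmulr_rgt0 _ nR0) (lt_le_trans _ np1)// invr_gt0.
      rewrite /W/= in_itv/=; apply/andP; split.
        rewrite /a invfM ler_pdivrMr// (le_trans np1)// mulrC ler_pM2l//.
        by rewrite ler_nat ltnW.
      by rewrite /b ler_pdivlMr// (le_trans _ np2)// mulrC ler_pM2r// ler_nat.
  - by move=> p pW; rewrite mule_ge0 ?H0// lee_fin w0.
  - by apply: emeasurable_funM; [apply/measurable_EFinP; exact: mw|exact: mH].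
have intW : (\int[mu]_(p in W) \sum_(N <= n < N + k) theta%:E * ((w n p)%:E * H n p) <=
    \int[mu]_(p in W) (S / p)%:E)%E.
  apply: ge0_le_integral => //.
  - by move=> p pW; apply: sume_ge0 => n _; exact: twH0.
  - exact: emeasurable_sum.
  - apply/measurable_EFinP; apply: measurable_funM => //.
    apply: measurable_fun_nonincreasing_itv => s t.
    rewrite !in_itv/= => /andP[sa _] /andP[ta _] st.
    by rewrite lef_pV2// posrE (lt_le_trans a0).
move=> /le_trans/(_ intW).
(* The prior mass [ln b - ln a] is [2 ln A + ln (N + k) - ln N]. *)
rewrite integral_inv// sumEFin lee_fin /a /b ln_div ?posrE// lnV ?posrE ?mulr_gt0//.
rewrite lnM ?posrE//.
have := ln_le_harmonic k N0.
move=> /(ler_wpM2l (mulr_ge0 theta0 c0)) h1 h2.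
apply: (le_trans h1); move: h2; rewrite mulr_sumr => /le_trans; apply.
by rewrite le_eqVlt; apply/orP; left; apply/eqP; ring.
Qed.

End bayes_lower_bound.

(** * No estimator beats the minimal asymptotic risk *)

Section minimax_lower_bound.
Context {R : realType}.
Variables (L : R -> R) (v : R).
Hypothesis L_ge0 : forall x : R, 0 < x -> 0 <= L x.
Hypothesis v_gt0 : 0 < v.
Hypothesis L_ni : {in `]0, v] &, nonincreasing_fun L}.
Hypothesis L_nd : {in `[v, +oo[ &, nondecreasing_fun L}.

Lemma risk_ge0 r (Pi : @Defs.family R) p : 0 < p < 1 -> (0 <= risk r L Pi p)%E.
Proof.
move=> p01; have [p0 _] := andP p01.
apply: nneseries_ge0 => n _ _; rewrite mule_ge0 ?lee_fin ?ibs_pmf_ge0//.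
exact: (conditional_risk_ge0 L_ge0).
Qed.

Lemma risk_le_sup_risk r (Pi : @Defs.family R) p : 0 < p < 1 ->
  (risk r L Pi p <= sup_risk r L Pi)%E.
Proof. by move=> p01; apply: ereal_sup_ubound; exists p => //=; rewrite in_itv. Qed.

(** If the supremum [S] were below [eta], there would be [theta < 1] and [c < eta] with
    [theta * c > S]. In [risk_bound_harmonic] the growing logarithm has coefficient [theta * c] on
    the left and [S] on the right, while the edge term stays fixed, so a large [k] gives a
    contradiction. *)
Lemma sup_risk_ge r (Pi : @Defs.family R) (eta : R) : estimator r.+1 Pi ->
  (forall c, 0 < c -> (eta%:E <= asym_risk r.+1 L c)%E) ->
  (forall c, 0 < c -> (asym_risk r.+1 L c < +oo)%E) ->
  (eta%:E <= sup_risk r.+1 L Pi)%E.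
Proof.
move=> est eta_le risk_lty; rewrite leNgt; apply/negP => Seta.
have h01 : 0 < (2^-1 : R) < 1 by apply/andP; split; lra.
have S0 : (0 <= sup_risk r.+1 L Pi)%E.
  exact: le_trans (risk_ge0 _ _ h01) (risk_le_sup_risk _ _ h01).
have SE : sup_risk r.+1 L Pi = (fine (sup_risk r.+1 L Pi))%:E.
  by rewrite fineK// ge0_fin_numE// (lt_trans Seta)// ltry.
move: S0 Seta; rewrite SE; set S := fine _; rewrite lee_fin lte_fin => S0 Seta.
pose c := (S + eta) / 2.
have [Sc ceta] : S < c /\ c < eta by rewrite /c; split; lra.
have c0 : 0 < c by rewrite (le_lt_trans S0).
(* The midpoint of [S / c] and [1], so that [theta * c] is the midpoint of [S] and [c]. *)
pose theta := (S / c + 1) / 2.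
have Sc1 : S / c < 1 by rewrite ltr_pdivrMr// mul1r.
have Sc0 : 0 <= S / c by rewrite divr_ge0// ltW.
have [t0 t1] : 0 <= theta /\ theta < 1 by rewrite /theta; split; lra.
have tc : 0 < theta * c - S.
  rewrite (_ : theta * c - S = (c - S) / 2); first by rewrite divr_gt0// subr_gt0.
  by rewrite /theta; field; exact: lt0r_neq0.
have [A [A1 cT]] := truncated_risk_ge L_ge0 v_gt0 L_ni L_nd eta_le risk_lty (ltW c0) ceta.
have [N [rN AN fge]] := ibs_pmf_ge_phi r t0 t1 (ltW A1).
have NR0 : 0 < N%:R :> R by rewrite ltr0n (leq_ltn_trans _ rN).
(* The value at which [ln (N + k) - ln N] would exceed what the bound allows; the [1] makes the
   contradiction strict. *)
pose X := S * (2 * ln A) / (theta * c - S) + 1 + ln N%:R.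
pose k := (Num.truncn (expR X)).+1.
have kX : X <= ln (N + k)%:R.
  rewrite -[leLHS]expRK ler_ln ?posrE ?expR_gt0//; last by rewrite ltr0n addn_gt0 orbT.
  by rewrite (le_trans (ltW (truncnS_gt _)))// ler_nat leq_addl.
have riskS p : 0 < p < 1 -> (risk r.+1 L Pi p <= S%:E)%E.
  by move=> p01; rewrite /S -SE; exact: risk_le_sup_risk.
have := risk_bound_harmonic L_ge0 v_gt0 L_ni L_nd k est S0 t0 (ltW c0) A1 rN AN
  fge cT riskS.
set Y := ln _ - ln _ => h.
have YX : S * (2 * ln A) / (theta * c - S) + 1 <= Y by rewrite /Y /X in kX *; lra.
have : (theta * c - S) * (S * (2 * ln A) / (theta * c - S) + 1) <= (theta * c - S) * Y.
  by rewrite ler_pM2l.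
rewrite mulrDr mulr1 mulrC divfK ?gt_eqF//; lra.
Qed.

End minimax_lower_bound.

Theorem corollary4 (R : realType) (r : nat) (L : R -> R)
  (r_ge3 : (3 <= r)%N)
  (L_ge0 : forall x, 0 < x -> 0 <= L x)
  (L_BV : forall x1 x2, 0 < x1 -> x1 < x2 -> bounded_variation x1 x2 L)
  (L_disc : finite_set [set x | 0 < x /\ ~ {for x, continuous L}])
  (L_Theta0 : exists2 K : R, K < r%:R & Theta_at0 L (fun x => x `^ K))
  (L_Thetay : exists2 K' : R, K' < r%:R & Theta_aty L (fun x => x `^ K'))
  (L_left : exists xi : R,
    [/\ 0 < xi, {in `]0, xi[ &, nonincreasing_fun L} &
        (0 < \int[lebesgue_measure]_(x in `]xi, +oo[)
               ((L xi - L x) / x ^+ r.+1)%:E)%E])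
  (L_right : exists xi' : R,
    [/\ 0 < xi', {in `]xi', +oo[ &, nondecreasing_fun L} &
        lim (L x @[x --> xi'^'-]) < lim (L x @[x --> xi'^'+]) \/
        (exists (t : nat) (I : interval R),
          [/\ (1 <= t)%N,
              [set` I] `<=` `]0, +oo[,
              xi' \in I /\ (exists2 y, y \in I & y != xi'),
              class_C t [set` I] L &
              (forall i, (1 <= i <= t.-1)%N ->
                 nderive_within [set` I] i L xi' = 0) /\
              0 < (-1) ^+ t.-1 * nderive_within [set` I] t L xi'])])
  (Omega : R) (Omega_gt0 : 0 < Omega)
  (Omega_min : forall Omega' : R, 0 < Omega' ->
    (asym_risk r L Omega <= asym_risk r L Omega')%E)
  (v v' : R) (v_gt0 : 0 < v) (v'_gt0 : 0 < v')
  (v_le : v <= Omega / (r%:R + Num.sqrt r%:R + 1))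
  (v'_ge : v' >= Omega / (r%:R - Num.sqrt r%:R))
  (L_cst : {in `[v, v'] &, forall x y, L x = L y})
  (L_noninc : {in `]0, v] &, nonincreasing_fun L})
  (L_nondec : {in `[v', +oo[ &, nondecreasing_fun L}) :
  minimax r L (nonrandomized (fun n => Omega / (n%:R + 1))).
Proof.
clear L_BV L_disc L_left L_right.
case: r r_ge3 L_Theta0 L_Thetay Omega_min v_le v'_ge => [|r] r_ge3.
  by rewrite ltn0 in r_ge3.
move=> [K _ TK] [K' K'r TK'] Omega_min v_le v'_ge.
(* Gluing the flat stretch to the nondecreasing one makes [L] unimodal with turning point [v], the
   form used by all auxiliary results. *)
have L_nd : {in `[v, +oo[ &, nondecreasing_fun L}.
  move=> s t; rewrite !in_itv/= !andbT => vs vt st.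
  have [v's|sv'] := leP v' s.
    by apply: L_nondec => //; rewrite in_itv/= andbT// (le_trans v's).
  have [v't|tv'] := leP v' t; last first.
    by rewrite (L_cst s t)// in_itv/= ?vs ?vt ltW.
  rewrite (L_cst s v') ?in_itv/= ?vs ?(ltW sv') ?lexx ?andbT//; last first.
    by rewrite (le_trans vs)// ltW.
  by apply: L_nondec => //; rewrite in_itv/= andbT.
(* The first-order condition involves the three shapes [r.+1], [r.+2] and [r.+3]. *)
have fin k c : 0 < c -> (asym_risk (r + k).+1 L c < +oo)%E.
  move=> c0; apply: (asym_risk_lty L_ge0 v_gt0 L_noninc L_nd c0); first by exists K.
  by exists K' => //; rewrite (lt_le_trans K'r)// ler_nat ltnS leq_addr.
have fin0 c : 0 < c -> (asym_risk r.+1 L c < +oo)%E by move=> /(fin 0 c); rewrite addn0.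
have next : (asym_risk r.+2 L Omega <= asym_risk r.+1 L Omega)%E.
  apply: (asym_risk_min_next L_ge0 v_gt0 L_noninc L_nd) => //.
    by have := fin 1 _ Omega_gt0; rewrite addn1.
  by have := fin 2 _ Omega_gt0; rewrite addn2.
have upper : (sup_risk r.+1 L (nonrandomized (fun n => Omega / (n%:R + 1))%R) <=
    asym_risk r.+1 L Omega)%E.
  apply: ge_ereal_sup => _ [p + <-]; rewrite /= in_itv/= => p01.
  exact: (risk_le_asym_risk L_ge0 v_gt0 L_noninc L_nd (ltnW r_ge3) Omega_gt0
    v_le v'_ge L_cst p01 next).
split.
  move=> n rn; rewrite /nonrandomized/= /step_cdf leNgt divr_gt0// ltr_wpDl//.
move=> Pi est; apply: (le_trans upper).
have AE : asym_risk r.+1 L Omega = (fine (asym_risk r.+1 L Omega))%:E.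
  by rewrite fineK// ge0_fin_numE ?fin0// (asym_risk_ge0 L_ge0).
rewrite AE; apply: (sup_risk_ge L_ge0 v_gt0 L_noninc L_nd) => // c c0.
by rewrite -AE; exact: Omega_min.
Qed.
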